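(* Define $\mathbf{d}=\{d_n\}_{n=1}^\infty$ by $d_1=17$, $d_2=19$, and $d_n=n^3$ for $n\ge3$. Let $\mathcal{F}=\mathcal{F}(\mathbf{d},4)$ and $\mathcal{G}=\mathcal{G}(\mathbf{d},4)$. Then the following hold. (1) $\dim_P(J_{\mathcal{F}})=\dim_H(J_{\mathcal{F}})$ and $\Pi_{\dim_H(J_{\mathcal{F}})}(J_{\mathcal{F}})=\infty$. (2) $\dim_P(J_{\mathcal{G}})=\dim_H(J_{\mathcal{G}})$ and $\Pi_{\dim_H(J_{\mathcal{G}})}(J_{\mathcal{G}})=\infty$. (3) $\dim_H(J_{\mathcal{G}})<\dim_H(J_{\mathcal{F}})<1/2$.
   Context: Notation. $\mathbb{N}$ is the set of positive integers, $\mathbb{D}=\{z\in\mathbb{C}:|z|<1\}$, $\mathbb{C}$ is identified with $\mathbb{R}^2$, $e(\theta)=e^{2\pi\sqrt{-1}\,\theta}$. $\dim_H,\dim_P$ are Hausdorff and packing dimension; $\Pi_t$ is the $t$-dimensional packing measure. Limit set. For a family $\mathcal{S}=\{s_i:X\to X\}_{i\in I}$ of injective contractions of a compact connected set $X$ with $\sup_i\mathrm{Lip}(s_i)<1$ ($I$ countable), the limit set is $J_{\mathcal{S}}=\bigcup_{\omega\in I^{\mathbb{N}}}\bigcap_{N\ge1}s_{\omega_1}\circ\dots\circ s_{\omega_N}(X)$. The systems. $\mathcal{D}$ is the set of real sequences $\{d_n\}_{n\ge1}$ with $d_1\ge2$ and $d_{n+1}-d_n\ge2$ for all $n$. For $\alpha\in\mathbb{C}$,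 $|\alpha|\ge2$, define $f_\alpha,g_\alpha:\overline{\mathbb{D}}\to\overline{\mathbb{D}}$ by $f_\alpha(z)=\frac{z+\overline{\alpha}}{|\alpha|^2-1}$, $g_\alpha(z)=\frac1{z+\alpha}$. For $\mathbf{d}=\{d_n\}\in\mathcal{D}$, $T\in\mathbb{N}$: $\mathcal{F}(\mathbf{d},T)=\{f_{e(j/T)d_n}:n\in\mathbb{N},\,j=0,\dots,T-1\}$ and $\mathcal{G}(\mathbf{d},T)=\{g_{e(j/T)d_n}:n\in\mathbb{N},\,j=0,\dots,T-1\}$, families of maps on $X=\overline{\mathbb{D}}$. *)

(* Defs.v *)
From mathcomp Require Import all_boot all_order all_algebra.
From mathcomp Require Import all_classical all_reals all_analysis.
From mathcomp Require Import complex.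

Set Implicit Arguments.
Unset Strict Implicit.
Unset Printing Implicit Defensive.

Import Order.TTheory GRing.Theory Num.Theory.

Local Open Scope classical_set_scope.
Local Open Scope ring_scope.

(* Euclidean distance on C = R^2; [`|z|] itself lives in [R[i]]. *)
Definition cdist {R : realType} (z w : R[i]) : R := complex.Re `|z - w|.

Definition cball {R : realType} (z : R[i]) (r : R) : set R[i] :=
  [set w | cdist z w <= r].

(* [diam set0 = -oo]. *)
Definition diam {R : realType} (U : set R[i]) : \bar R :=
  ereal_sup [set (cdist z w)%:E | z in U & w in U].

(* Empty members of a cover contribute 0 for every exponent, including t = 0. *)
Definition diam_pow {R : realType} (t : R) (U : set R[i]) : \bar R :=
  if U == set0 then 0%E else (diam U `^ t)%E.

Definition delta_cover {R : realType} (delta : R) (A : set R[i])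
    (U : nat -> set R[i]) : Prop :=
  A `<=` \bigcup_k U k /\ forall k, (diam (U k) <= delta%:E)%E.

Definition hausdorff_pre {R : realType} (t delta : R) (A : set R[i]) : \bar R :=
  ereal_inf [set (\sum_(0 <= k <oo) diam_pow t (U k))%E
            | U in [set U | delta_cover delta A U]].

(* The limit as delta -> 0+ is a supremum, by monotonicity in delta. *)
Definition hausdorff_measure {R : realType} (t : R) (A : set R[i]) : \bar R :=
  ereal_sup [set hausdorff_pre t delta A | delta in [set delta | 0 < delta]].

Definition hausdorff_dim {R : realType} (A : set R[i]) : \bar R :=
  ereal_inf [set t%:E | t in [set t | 0 <= t /\ hausdorff_measure t A = 0%E]].

(* A packing is a set of pairs (centre, radius); disjointness of the balls
   makes it countable. *)
Definition delta_packing {R : realType} (delta : R) (A : set R[i])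
    (P : set (R[i] * R)) : Prop :=
  (forall p, P p -> A p.1 /\ 0 < p.2 <= delta) /\
  trivIset P (fun p => cball p.1 p.2).

(* The limit as delta -> 0+ is an infimum, by monotonicity in delta. *)
Definition packing_pre {R : realType} (t : R) (A : set R[i]) : \bar R :=
  ereal_inf [set ereal_sup [set (\esum_(p in P) ((2 * p.2) `^ t)%:E)%E
                           | P in [set P | delta_packing delta A P]]
            | delta in [set delta | 0 < delta]].

Definition packing_measure {R : realType} (t : R) (A : set R[i]) : \bar R :=
  ereal_inf [set (\sum_(0 <= k <oo) packing_pre t (B k))%E
            | B in [set B : nat -> set R[i] | A `<=` \bigcup_k B k]].

Definition packing_dim {R : realType} (A : set R[i]) : \bar R :=
  ereal_inf [set t%:E | t in [set t | 0 <= t /\ packing_measure t A = 0%E]].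

Fixpoint compose_word {X I : Type} (s : I -> X -> X) (w : nat -> I) (N : nat)
    : X -> X :=
  if N is N'.+1 then compose_word s w N' \o s (w N') else id.

Definition limit_set {X I : Type} (s : I -> X -> X) (D : set X) : set X :=
  \bigcup_(w in [set: nat -> I])
    \bigcap_(N in [set N | (1 <= N)%N]) (compose_word s w N @` D).

Definition closed_disk {R : realType} : set R[i] := [set z | `|z| <= 1].

Definition e2pi {R : realType} (theta : R) : R[i] :=
  Complex (cos (2 * pi * theta)) (sin (2 * pi * theta)).

Definition f_map {R : realType} (alpha z : R[i]) : R[i] :=
  (z + conjc alpha) / (`|alpha| ^+ 2 - 1).

Definition g_map {R : realType} (alpha z : R[i]) : R[i] := (z + alpha)^-1.

(* The first component n of an index stands for the (n+1)-st term of the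
   sequence: [d 0] is never used. *)
Definition sys_param {R : realType} (d : nat -> R) (T : nat) (i : nat * 'I_T)
    : R[i] :=
  e2pi (i.2%:R / T%:R) * (d i.1.+1)%:C%C.

Definition Fsys {R : realType} (d : nat -> R) (T : nat) (i : nat * 'I_T)
    : R[i] -> R[i] :=
  f_map (sys_param d i).

Definition Gsys {R : realType} (d : nat -> R) (T : nat) (i : nat * 'I_T)
    : R[i] -> R[i] :=
  g_map (sys_param d i).

Arguments Fsys {R} d T i.
Arguments Gsys {R} d T i.

(* Main.v *)
Require Import Defs.
From mathcomp Require Import all_boot all_order all_algebra.
From mathcomp Require Import all_classical all_reals all_analysis.
From mathcomp Require Import complex.
From mathcomp Require Import ring lra.

(* Both systems are conformal with uniformly bounded distortion: if rho w is
   the modulus of the derivative at 0 of the composition coded by the word w, then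
   rho (u ++ v) and rho u * rho v agree up to a factor 3. Let h be the Hausdorff
   dimension and Z n t the sum of rho w ^ t over the words of length n. Covering by
   cylinders shows that Z n h cannot be small, and a path through the words that
   avoids a putative cheap cover shows that Z n h cannot be large, so Z n h is
   pinched between two constants.

   For t > h this makes the packing sums finite, because h >= 1/3: a ball of a
   packing either contains the image of 0 under the parent of the first cylinder
   it contains, which happens once per parent, or has radius at most of order
   rho v * n ^ -3, and the sum of n ^ (-3t) converges. At t = h a Baire argument on
   codes reduces the claim to packings centred in a dense subset of a cylinder;
   placing a ball of radius rho u * n ^ -4 (the distance from the n-th disk to the
   other ones) at the first letter n >= n0 of each code gives a total
   weight of order n0 ^ (2h), since the cylinders themselves, whose diameters are of
   order n ^ -6, have total weight of order 1.

   Finally the sum of |z + alpha| ^ -2 over the four rotations of alpha is at most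
   4 / (|alpha| ^ 2 - 1/2) when |z| <= 1/16, hence smaller than the sum for the
   similarities, and concavity of x ^ h carries this to the exponent h. *)

Set Implicit Arguments.
Unset Strict Implicit.
Unset Printing Implicit Defensive.

Import Order.TTheory GRing.Theory Num.Theory.

Local Open Scope classical_set_scope.
Local Open Scope ring_scope.

Local Notation letter := (nat * 'I_4)%type.

(** * Real modulus, real powers and geometric error bounds *)

Section Prelim.
Context {R : realType}.
Implicit Types (x y z : R[i]) (a b s t : R).

Definition nm z : R := complex.Re `|z|.

Lemma nmE z : `|z| = (nm z)%:C%C.
Proof. by rewrite /nm normc_def. Qed.

Lemma cdistE z y : cdist z y = nm (z - y). Proof. by []. Qed.

Lemma nmM x y : nm (x * y) = nm x * nm y.
Proof. by apply: (@complexI R); rewrite rmorphM /= -!nmE normrM. Qed.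

Lemma nmV x : nm x^-1 = (nm x)^-1.
Proof. by apply: (@complexI R); rewrite fmorphV /= -!nmE normfV. Qed.

Lemma nm0 : nm 0 = 0.
Proof. by rewrite /nm normr0. Qed.

Lemma nmN x : nm (- x) = nm x. Proof. by rewrite /nm normrN. Qed.

Lemma nmB x y : nm (x - y) = nm (y - x). Proof. by rewrite /nm distrC. Qed.

Lemma ler_nmD x y : nm (x + y) <= nm x + nm y.
Proof. by rewrite -lecR rmorphD /= -!nmE ler_normD. Qed.

Lemma nm_ge0 x : 0 <= nm x.
Proof. by rewrite -lecR -nmE normr_ge0. Qed.

Lemma nm_eq0 x : nm x = 0 -> x = 0.
Proof. by move=> h; apply/eqP; rewrite -normr_eq0 nmE h. Qed.

Lemma nm_sqr x : nm x ^+ 2 = complex.Re x ^+ 2 + complex.Im x ^+ 2.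
Proof. by rewrite /nm normc_def /= sqr_sqrtr // addr_ge0 ?sqr_ge0. Qed.

Lemma ler_nm_triangle y x z : nm (x - z) <= nm (x - y) + nm (y - z).
Proof. by have := ler_nmD (x - y) (y - z); rewrite addrA subrK. Qed.

Lemma nm_le_ReIm x : nm x <= `|complex.Re x| + `|complex.Im x|.
Proof.
rewrite -(@ler_pXn2r _ 2) ?nnegrE ?addr_ge0 ?nm_ge0 //.
rewrite nm_sqr -(real_normK (num_real (complex.Re x))) -(real_normK (num_real (complex.Im x))).
by rewrite sqrrD lerD2r lerDl mulrn_wge0 // mulr_ge0.
Qed.

Lemma Re_le_nm x : `|complex.Re x| <= nm x.
Proof.
rewrite -(@ler_pXn2r _ 2) ?nnegrE ?nm_ge0 //.
by rewrite nm_sqr real_normK ?num_real // lerDl sqr_ge0.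
Qed.

Lemma Im_le_nm x : `|complex.Im x| <= nm x.
Proof.
rewrite -(@ler_pXn2r _ 2) ?nnegrE ?nm_ge0 //.
by rewrite nm_sqr real_normK ?num_real // lerDr sqr_ge0.
Qed.

Lemma closed_diskE x : closed_disk x <-> nm x <= 1.
Proof. by rewrite /closed_disk /= nmE -(lecR (nm x) 1). Qed.

(** Convexity of exp at [ln a] and [ln b]. It gives convexity in the exponent below and, much later,
    concavity of [x ^ t] in the base. *)
Lemma powR_young a b (p : R) : 0 < a -> 0 < b -> 0 <= p <= 1 ->
  a `^ p * b `^ (1 - p) <= p * a + (1 - p) * b.
Proof.
move=> a0 b0 /andP[p0 p1].
have := @convex_expR R (Itv01 p0 p1) (ln a) (ln b).
rewrite convRE /= convRE !lnK ?posrE // => h.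
rewrite /powR !gt_eqF // -expRD.
exact: h.
Qed.

Lemma powRD_gt0 a s t : 0 < a -> a `^ (s + t) = a `^ s * a `^ t.
Proof. by move=> a0; rewrite powRD // (gt_eqF a0) /= implybT. Qed.

Lemma convex_powR_exp a s t (p : R) : 0 < a -> 0 <= p <= 1 ->
  a `^ (p * s + (1 - p) * t) <= p * a `^ s + (1 - p) * a `^ t.
Proof.
move=> a0 p01; rewrite powRD_gt0 //.
by rewrite mulrC (mulrC p s) (mulrC (1 - p)) !powRrM mulrC powR_young ?powR_gt0.
Qed.

Lemma ler_sum_subset (T : eqType) (s1 s2 : seq T) (f : T -> R) :
  uniq s1 -> {subset s1 <= s2} -> (forall i, 0 <= f i) ->
  \sum_(i <- s1) f i <= \sum_(i <- s2) f i.
Proof.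
move=> + + f0; elim: s1 s2 => [|x s1 IH] s2 /=.
  by move=> _ _; rewrite big_nil sumr_ge0.
move=> /andP[xs1 us1] sub.
have xs2 : x \in s2 by rewrite sub ?mem_head.
rewrite big_cons (perm_big _ (perm_to_rem xs2)) big_cons lerD2l.
apply: IH => // y ys1.
have := sub y; rewrite inE ys1 orbT => /(_ isT).
rewrite (perm_mem (perm_to_rem xs2)) inE => /orP[/eqP yx|//].
by rewrite -yx ys1 in xs1.
Qed.

(** Dividing by [(n+1) ^ (-s)] leaves [(1 - 1/(n+1)) ^ (-s) >= 1 + s/(n+1)], which follows from
    [exp x >= 1 + x] and [ln (1 + x) <= x]. *)
Lemma powR_neg_telescope (n : nat) s : 0 < s -> (0 < n)%N ->
  s * n.+1%:R `^ (- (s + 1)) <= n%:R `^ (- s) - n.+1%:R `^ (- s).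
Proof.
move=> s0 n0.
have N0 : 0 < n.+1%:R :> R by rewrite ltr0n.
have n0' : 0 < n%:R :> R by rewrite ltr0n.
have -> : - (s + 1) = - s + (- 1) by rewrite opprD.
rewrite powRD_gt0 //.
rewrite powR_inv1 ?ler0n // lerBrDl.
have -> : n%:R = n.+1%:R * (1 + - n.+1%:R^-1) :> R.
  by rewrite mulrDr mulr1 mulrN mulfV ?gt_eqF // -natr1 addrK.
have u1 : 0 < 1 - n.+1%:R^-1 :> R by rewrite subr_gt0 invf_lt1 // ltr1n.
rewrite powRM ?ler0n ?(ltW u1) // mulrCA -{1}(mulr1 (n.+1%:R `^ (- s))) -mulrDr.
rewrite ler_pM2l ?powR_gt0 // /powR (gt_eqF u1).
apply: le_trans (expR_ge1Dx _).
rewrite lerD2l mulNr -mulrN ler_pM2l // lerNr.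
by apply: le_ln1Dx; rewrite ltrN2 invf_lt1 // ltr1n.
Qed.

(** A discrete integral test: from the second term on, the sum telescopes through
    [powR_neg_telescope] with exponent [s - 1]. *)
Lemma psum_bounded s : 1 < s -> exists C : R, 0 < C /\
  forall M, \sum_(n < M) n.+1%:R `^ (- s) <= C.
Proof.
move=> s1; have t0 : 0 < s - 1 by rewrite subr_gt0.
exists (1 + (s - 1)^-1); split; first by rewrite addr_gt0 ?invr_gt0.
have H n : \sum_(i < n.+1) i.+1%:R `^ (- s) <=
    1 + (s - 1)^-1 * (1 - n.+1%:R `^ (- (s - 1))).
  elim: n => [|n IH]; first by rewrite big_ord1 !powR1 subrr mulr0 addr0.
  rewrite big_ord_recr /=; apply: le_trans (lerD IH (lexx _)) _.
  rewrite -addrA lerD2l -lerBrDl -mulrBr ler_pdivlMl //.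
  have := powR_neg_telescope t0 (ltn0Sn n); rewrite subrK => h.
  apply: le_trans h _; lra.
case=> [|n]; first by rewrite big_ord0 addr_ge0 ?invr_ge0 ?(ltW t0).
apply: le_trans (H n) _; by rewrite lerD2l ger_pMr ?invr_gt0 // gerBl powR_ge0.
Qed.

(* Right continuity in the exponent: f^(t+e) >= f^t (1 + e ln f). *)
Lemma sum_powR_right (T : Type) (W : seq T) (f : T -> R) t (C : R) :
  (forall i, 0 < f i <= 1) -> C < \sum_(i <- W) f i `^ t ->
  exists2 s, t < s < t + 1/2 & C < \sum_(i <- W) f i `^ s.
Proof.
move=> f01 hC.
pose S := \sum_(i <- W) f i `^ t.
pose M := \sum_(i <- W) f i `^ t * - ln (f i).
have M0 : 0 <= M.
  apply: sumr_ge0 => x _; rewrite mulr_ge0 ?powR_ge0 // oppr_ge0 ln_le0 //.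
  by case/andP: (f01 x).
(* The cap 1/4 keeps the exponent below [t + 1/2]; the other term makes the first-order loss [e * M]
   smaller than the slack [S - C]. *)
pose e := Num.min (1/4) ((S - C) / (2 * (M + 1))).
have e0 : 0 < e.
  rewrite lt_min; apply/andP; split; first lra.
  by apply: divr_gt0; [rewrite subr_gt0|lra].
exists (t + e); first by rewrite ltrDl e0 ltrD2l gt_min; apply/orP; left; lra.
have eM : e * M < S - C.
  have : e <= (S - C) / (2 * (M + 1)) by rewrite ge_min lexx orbT.
  have M1 : 0 < 2 * (M + 1) by lra.
  rewrite ler_pdivlMr // => he.
  have : 0 < S - C by rewrite subr_gt0.
  nra.
have : S - e * M <= \sum_(i <- W) f i `^ (t + e).
  rewrite /S /M mulr_sumr -sumrB; apply: ler_sum => x _.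
  have /andP[fx0 _] := f01 x.
  rewrite powRD_gt0 //.
  rewrite mulrCA -{1}(mulr1 (f x `^ t)) -mulrBr ler_pM2l ?powR_gt0 //.
  by rewrite mulrN opprK {1}/powR (gt_eqF fx0) expR_ge1Dx.
apply: lt_le_trans; lra.
Qed.

(** Completeness with an explicit error: the limit is the supremum of the lower bounds
    [u n - e n]. *)
Lemma squeeze_point (u e : nat -> R) : (forall n m, u n - e n <= u m + e m) ->
  exists l, forall n, `|u n - l| <= e n.
Proof.
move=> h; pose A := [set u n - e n | n in setT].
have hs : has_sup A.
  split; first by exists (u 0%N - e 0%N), 0%N.
  by exists (u 0%N + e 0%N) => _ [n _ <-].
exists (sup A) => n; rewrite ler_norml; apply/andP; split.
- suff : sup A <= u n + e n by lra.
  by apply: (ge_sup hs.1) => _ [m _ <-].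
- suff : u n - e n <= sup A by lra.
  by apply: (sup_upper_bound hs); exists n.
Qed.

Lemma geom_small (C q e : R) : 0 <= C -> 0 <= q < 1 -> 0 < e ->
  exists n0 : nat, forall n, (n0 <= n)%N -> C * q ^+ n < e.
Proof.
move=> C0 /andP[q0 q1] e0.
have q1' : `|q| < 1 by rewrite ger0_norm.
have /cvgrPdist_lt /(_ e e0) [n0 _ H] := @cvg_geometric R C q q1'.
exists n0 => n nn; have := H n nn.
by rewrite sub0r normrN /geometric /= ger0_norm // mulr_ge0 // exprn_ge0.
Qed.

Lemma ler0_geom (x C q : R) : 0 <= C -> 0 <= q < 1 ->
  (forall n : nat, x <= C * q ^+ n) -> x <= 0.
Proof.
move=> C0 q01 h; rewrite leNgt; apply/negP => x0.
have [n0 /(_ n0 (leqnn _))] := geom_small C0 q01 x0.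
by rewrite ltNge h.
Qed.
End Prelim.

(* [der a z] is the modulus of the derivative of [phi a] at [z], and [a.1.+1] is
   the index [n] of [d_n]. The gap condition is restricted to [nm z <= 1/16]
   because the images of the unit disk for [d_1 = 17] and [d_2 = 19] touch at
   [1/18]. *)
Record conformal_system {R : realType} (phi : letter -> R[i] -> R[i])
    (der : letter -> R[i] -> R) : Prop := {
  cs_small : forall a z, nm z <= 1 -> nm (phi a z) <= 1/16;
  cs_dist : forall a z w, nm z <= 1 -> nm w <= 1 ->
    nm (phi a z - phi a w) ^+ 2 = nm (z - w) ^+ 2 * (der a z * der a w);
  cs_distortion : forall a z w, nm z <= 1 -> nm w <= 1 ->
    der a z <= der a w * (1 + nm (z - w) / 4);
  cs_der_gt0 : forall a z, nm z <= 1 -> 0 < der a z;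
  cs_der_le : forall a z, nm z <= 1 -> der a z <= 1/4;
  cs_der_decay : forall a z, nm z <= 1 -> der a z <= 2 / a.1.+1%:R ^+ 6;
  cs_gap : exists2 c : R, 0 < c & forall a b z w, a != b ->
    nm z <= 1/16 -> nm w <= 1/16 ->
    c / a.1.+1%:R ^+ 4 <= nm (phi a z - phi b w);
  cs_decay : forall a z, nm z <= 1 -> nm (phi a z) <= 2 / a.1.+1%:R ^+ 3;
  cs_sum_gt1 : exists (L : seq letter) (lam : R), uniq L /\ 1 < lam /\
    forall z, nm z <= 1/16 -> lam <= \sum_(a <- L) der a z `^ (1/3);
  cs_sum_lt1 : exists2 q : R, q < 1 & forall (L : seq letter) z, uniq L ->
    nm z <= 1/16 -> \sum_(a <- L) der a z `^ (1/2) <= q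
}.

(** * Compositions along words and bounded distortion *)

Section System.
Context {R : realType}.
Variables (phi : letter -> R[i] -> R[i]) (der : letter -> R[i] -> R).
Hypothesis S : conformal_system phi der.
Implicit Types (a b : letter) (u v w : seq letter) (z x y : R[i]) (s : nat -> letter).

Fixpoint wmap w z : R[i] := if w is a :: w' then phi a (wmap w' z) else z.
Fixpoint wder w z : R :=
  if w is a :: w' then der a (wmap w' z) * wder w' z else 1.
Definition rho w : R := wder w 0.

Lemma nm0_le1 : nm (0 : R[i]) <= 1.
Proof. by rewrite nm0. Qed.
Hint Resolve nm0_le1 : core.

Lemma wmap_cat u v z : wmap (u ++ v) z = wmap u (wmap v z).
Proof. by elim: u => //= a u ->. Qed.

Lemma wder_cat u v z : wder (u ++ v) z = wder u (wmap v z) * wder v z.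
Proof. by elim: u => /= [|a u ->]; rewrite ?mul1r ?wmap_cat ?mulrA. Qed.

Lemma wmap_le1 w z : nm z <= 1 -> nm (wmap w z) <= 1.
Proof.
move=> z1; elim: w => //= a w /(cs_small S a) /le_trans; apply; lra.
Qed.

Lemma wmap_small w z : nm z <= 1/16 -> nm (wmap w z) <= 1/16.
Proof.
case: w => //= a w z1; apply: (cs_small S); apply: wmap_le1.
apply: le_trans z1 _; lra.
Qed.

Lemma wder_gt0 w z : nm z <= 1 -> 0 < wder w z.
Proof.
move=> z1; elim: w => //= a w IH.
by rewrite mulr_gt0 // (cs_der_gt0 S) // wmap_le1.
Qed.

Lemma wder_le w z : nm z <= 1 -> wder w z <= (1/4) ^+ size w.
Proof.
move=> z1; elim: w => //= a w IH; rewrite exprS.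
have w1 := wmap_le1 w z1.
by apply: ler_pM => //; [exact/ltW/(cs_der_gt0 S)|exact/ltW/wder_gt0|exact: (cs_der_le S)].
Qed.

Lemma rho_gt0 w : 0 < rho w. Proof. exact: wder_gt0. Qed.

Lemma rho_ge0 w : 0 <= rho w. Proof. exact/ltW/rho_gt0. Qed.

Lemma rho_le w : rho w <= (1/4) ^+ size w. Proof. exact: wder_le. Qed.

Lemma rho_le1 w : rho w <= 1.
Proof. apply: le_trans (rho_le w) _; apply: exprn_ile1; lra. Qed.

(** The identity [|m z - m x|^2 = |z - x|^2 |m' z| |m' x|] of Moebius maps is stable under
    composition. It turns bounds on the derivative into Lipschitz bounds from both sides, with no
    mean value theorem. *)
Lemma wmap_dist_sqr w z x : nm z <= 1 -> nm x <= 1 ->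
  nm (wmap w z - wmap w x) ^+ 2 = nm (z - x) ^+ 2 * (wder w z * wder w x).
Proof.
move=> z1 x1; elim: w => [|a w IH] /=; first by rewrite !mulr1.
rewrite (cs_dist S) ?wmap_le1 // IH; ring.
Qed.

Lemma phi_lip a z x : nm z <= 1 -> nm x <= 1 ->
  nm (phi a z - phi a x) <= 1/4 * nm (z - x).
Proof.
move=> z1 x1; have n0 := nm_ge0 (z - x).
rewrite -(@ler_pXn2r _ 2) ?nnegrE ?nm_ge0 ?mulr_ge0 //.
rewrite (cs_dist S) // exprMn mulrC ler_wpM2r ?sqr_ge0 // expr2.
by apply: ler_pM; rewrite ?(cs_der_le S) //; apply/ltW/(cs_der_gt0 S).
Qed.

(* The factors are peeled off from the innermost letter, so that the
   increments of the argument decrease geometrically. *)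
Lemma wder_distortion w z x : nm z <= 1 -> nm x <= 1 ->
  wder w z <= wder w x * (1 + nm (z - x)).
Proof.
elim/last_ind: w z x => [|w a IH] z x z1 x1 /=.
  by rewrite mul1r lerDl nm_ge0.
rewrite -cats1 !wder_cat /= !mulr1.
have pz := cs_small S a z1; have px := cs_small S a x1.
have pz1 : nm (phi a z) <= 1 by lra.
have px1 : nm (phi a x) <= 1 by lra.
have h1 := IH _ _ pz1 px1.
have h2 := cs_distortion S a z1 x1.
have h3 := phi_lip a z1 x1.
have D1 := wder_gt0 w px1; have D2 := cs_der_gt0 S a x1.
have D3 := cs_der_gt0 S a z1; have D4 := wder_gt0 w pz1.
have u0 := nm_ge0 (z - x).
have u2 : nm (z - x) <= 2 by have := ler_nmD z (- x); rewrite nmN; lra.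
apply: le_trans (ler_pM (ltW D4) (ltW D3) h1 h2) _.
rewrite mulrACA; apply: ler_wpM2l; first exact/ltW/mulr_gt0.
nra.
Qed.

(** Moving the base point to 0 costs at most [1 + nm z <= 2]; the constant 3 leaves some room. *)
Lemma wder_le_rho w z : nm z <= 1 -> wder w z <= 3 * rho w.
Proof.
move=> z1; apply: le_trans (wder_distortion w z1 nm0_le1) _.
rewrite subr0 mulrC; have := rho_gt0 w; rewrite -/(rho w); nra.
Qed.

Lemma rho_le_wder w z : nm z <= 1 -> rho w <= 3 * wder w z.
Proof.
move=> z1; apply: le_trans (wder_distortion w nm0_le1 z1) _.
rewrite sub0r nmN mulrC; have := wder_gt0 w z1; nra.
Qed.

Lemma wmap_dist_le w z x : nm z <= 1 -> nm x <= 1 ->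
  nm (wmap w z - wmap w x) <= 3 * rho w * nm (z - x).
Proof.
move=> z1 x1; have n0 := nm_ge0 (z - x); have r0 := rho_gt0 w.
rewrite -(@ler_pXn2r _ 2) ?nnegrE ?nm_ge0 ?mulr_ge0 ?rho_ge0 //.
rewrite wmap_dist_sqr // exprMn mulrC ler_wpM2r ?sqr_ge0 // expr2.
by apply: ler_pM; rewrite ?wder_le_rho //; apply/ltW/wder_gt0.
Qed.

Lemma wmap_dist_ge w z x : nm z <= 1 -> nm x <= 1 ->
  rho w / 3 * nm (z - x) <= nm (wmap w z - wmap w x).
Proof.
move=> z1 x1; have n0 := nm_ge0 (z - x); have r0 := rho_gt0 w.
rewrite -(@ler_pXn2r _ 2) ?nnegrE ?nm_ge0 ?mulr_ge0 ?divr_ge0 ?rho_ge0 //.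
rewrite wmap_dist_sqr // exprMn mulrC ler_wpM2l ?sqr_ge0 // expr2.
have h1 := rho_le_wder w z1; have h2 := rho_le_wder w x1.
by apply: ler_pM; rewrite ?divr_ge0 ?rho_ge0 //; lra.
Qed.

Lemma rho_cat_le u v : rho (u ++ v) <= 3 * rho u * rho v.
Proof.
rewrite /rho wder_cat ler_wpM2r //; first exact/ltW/wder_gt0.
by rewrite wder_le_rho // wmap_le1.
Qed.

Lemma rho_cat_ge u v : rho u * rho v <= 3 * rho (u ++ v).
Proof.
rewrite /rho wder_cat mulrA ler_wpM2r //; first exact/ltW/wder_gt0.
by rewrite rho_le_wder // wmap_le1.
Qed.

(** * The coding map *)

Lemma wmap_prefix_dist s n m x y : nm x <= 1 -> nm y <= 1 -> (n <= m)%N ->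
  nm (wmap (mkseq s n) x - wmap (mkseq s m) y) <= 6 * (1/4) ^+ n.
Proof.
move=> x1 y1 nm_.
have -> : mkseq s m = mkseq s n ++ map s (iota n (m - n)).
  by rewrite /mkseq -map_cat -iotaD subnKC.
rewrite wmap_cat; set y' := wmap _ y.
have y'1 : nm y' <= 1 by apply: wmap_le1.
apply: le_trans (wmap_dist_le _ x1 y'1) _.
have h := rho_le (mkseq s n); rewrite size_mkseq in h.
have h2 : nm (x - y') <= 2 by have := ler_nmD x (- y'); rewrite nmN; lra.
have := rho_gt0 (mkseq s n); have := nm_ge0 (x - y'); nra.
Qed.

Lemma coding_exists s : exists z, forall n,
  nm (wmap (mkseq s n) 0 - z) <= 12 * (1/4) ^+ n.
Proof.
pose p n := wmap (mkseq s n) 0; pose e n : R := 6 * (1/4) ^+ n.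
have h n m : nm (p n - p m) <= e n + e m.
  have e0 k : 0 <= e k by rewrite mulr_ge0 // exprn_ge0 //; lra.
  have [le|/ltnW le] := leqP n m.
    by apply: le_trans (wmap_prefix_dist s nm0_le1 nm0_le1 le) _; rewrite lerDl.
  by rewrite nmB; apply: le_trans (wmap_prefix_dist s nm0_le1 nm0_le1 le) _; rewrite lerDr.
have hr n m : complex.Re (p n) - e n <= complex.Re (p m) + e m.
  have := Re_le_nm (p n - p m); rewrite raddfB /= => h1.
  have := le_trans h1 (h n m); rewrite ler_norml; lra.
have hi n m : complex.Im (p n) - e n <= complex.Im (p m) + e m.
  have := Im_le_nm (p n - p m); rewrite raddfB /= => h1.
  have := le_trans h1 (h n m); rewrite ler_norml; lra.
have [lr hlr] := squeeze_point hr; have [li hli] := squeeze_point hi.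
(* The real and the imaginary part each contribute an error [6 * (1/4) ^ n], whence the constant
   12. *)
exists (Complex lr li) => n; apply: le_trans (nm_le_ReIm _) _.
have := hlr n; have := hli n; rewrite !raddfB /= /e; lra.
Qed.

Definition code s : R[i] := projT1 (cid (coding_exists s)).

Lemma code_approx s n : nm (wmap (mkseq s n) 0 - code s) <= 12 * (1/4) ^+ n.
Proof. exact: (projT2 (cid (coding_exists s))). Qed.

Lemma nm_le_approx z (c C : R) (p : nat -> R[i]) : 0 <= C ->
  (forall n, nm (p n) <= c) -> (forall n, nm (p n - z) <= C * (1/4) ^+ n) -> nm z <= c.
Proof.
move=> C0 pc pz; rewrite -subr_le0; apply: (@ler0_geom _ _ C (1/4)) => //; first lra.
move=> n; have := ler_nmD (p n) (z - p n); rewrite addrC subrK (nmB z).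
have := pc n; have := pz n; lra.
Qed.

Lemma approx_unique z x (C : R) (p : nat -> R[i]) : 0 <= C ->
  (forall n, nm (p n - z) <= C * (1/4) ^+ n) ->
  (forall n, nm (p n - x) <= C * (1/4) ^+ n) -> z = x.
Proof.
move=> C0 pz px; apply/eqP; rewrite -subr_eq0; apply/eqP/nm_eq0/eqP.
rewrite eq_le nm_ge0 andbT; apply: (@ler0_geom _ _ (2 * C) (1/4)); [lra|lra|].
move=> n; apply: le_trans (ler_nm_triangle (p n) z x) _.
have := pz n; have := px n; rewrite (nmB z); lra.
Qed.

Lemma code_le1 s : nm (code s) <= 1.
Proof.
apply: (@nm_le_approx _ _ 12 (fun n => wmap (mkseq s n) 0)) => // n.
- exact: wmap_le1.
- exact: code_approx.
Qed.

Definition shift n s : nat -> letter := fun k => s (n + k)%N.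

Lemma mkseq_shift s n : mkseq s n.+1 = s 0%N :: mkseq (shift 1 s) n.
Proof.
rewrite /mkseq /=; congr (_ :: _); have := iotaDl 1 0 n; rewrite addn0 => ->.
by rewrite -map_comp.
Qed.

(** [phi] contracts by 1/4, the rate of the error bound, so the prefixes of [s] approximate both
    sides with the same constant 12. *)
Lemma code_cons s : code s = phi (s 0%N) (code (shift 1 s)).
Proof.
apply: (@approx_unique _ _ 12 (fun n => wmap (mkseq s n) 0)) => // n.
  exact: code_approx.
case: n => [|n].
  rewrite /= expr0 sub0r nmN mulr1.
  by apply: le_trans (cs_small S _ (code_le1 _)) _; lra.
rewrite mkseq_shift.
rewrite /= exprS mulrCA; apply: le_trans (phi_lip _ _ (code_le1 _)) _.
  exact: wmap_le1.
by rewrite ler_wpM2l // ?code_approx //; lra.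
Qed.

Lemma code_small s : nm (code s) <= 1/16.
Proof. by rewrite code_cons; apply/(cs_small S)/code_le1. Qed.

Lemma code_shift n s : code s = wmap (mkseq s n) (code (shift n s)).
Proof.
elim: n s => [|n IH] s //.
by rewrite code_cons (IH (shift 1 s)) mkseq_shift.
Qed.

Lemma compose_wordE s n z : compose_word phi s n z = wmap (mkseq s n) z.
Proof.
elim: n z => [|n IH] z //.
by rewrite mkseqS -cats1 wmap_cat [LHS]/= IH.
Qed.

Lemma limit_setE : limit_set phi closed_disk = range code.
Proof.
apply/seteqP; split => [z [s _ hz]|_ [s _ <-]].
  exists s => //; apply: (@approx_unique _ _ 12 (fun n => wmap (mkseq s n) 0)) => // n.
    exact: code_approx.
  (* The limit set intersects over lengths at least 1 only, so the bound for the empty prefix is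
     read off at length 1. *)
  case: n => [|n].
    have [y /closed_diskE y1 <-] := hz 1%N isT.
    rewrite /= sub0r nmN expr0 mulr1.
    by apply: le_trans (cs_small S _ y1) _; lra.
  have [y /closed_diskE y1 <-] := hz n.+1 isT; rewrite compose_wordE.
  apply: le_trans (wmap_prefix_dist s nm0_le1 y1 (leqnn _)) _.
  by rewrite ler_wpM2r ?exprn_ge0 //; lra.
exists s => // n _; exists (code (shift n s)); first exact/closed_diskE/code_le1.
by rewrite compose_wordE -code_shift.
Qed.

(** Strictly growing nested words determine an infinite code. This ends both the path avoiding a
    cheap cover and the Baire argument. *)
Lemma chain_limit (f : nat -> seq letter) :
  (forall k, exists2 v, v != [::] & f k.+1 = f k ++ v) ->
  exists s, forall k, f k = mkseq s (size (f k)) /\ (k <= size (f k))%N.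
Proof.
move=> h; pose a0 : letter := (0%N, ord0).
have sz k : (k <= size (f k))%N.
  elim: k => // k IH; have [v v0 ->] := h k; rewrite size_cat.
  by case: v v0 => // a v _ /=; rewrite addnS ltnS (leq_trans IH) ?leq_addr.
have pre k n : (size (f k) <= size (f (k + n)))%N /\
    forall i, (i < size (f k))%N -> nth a0 (f (k + n)%N) i = nth a0 (f k) i.
  elim: n => [|n [IH1 IH2]]; first by rewrite addn0.
  have [v _ e] := h (k + n)%N; rewrite addnS e; split.
    by rewrite size_cat (leq_trans IH1) ?leq_addr.
  by move=> i ik; rewrite nth_cat (leq_trans ik IH1) IH2.
(* The word [f i.+1] has length greater than [i], so the default letter [a0] is never read. *)
exists (fun i => nth a0 (f i.+1) i) => k; split => //.
apply: (@eq_from_nth _ a0); first by rewrite size_mkseq.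
move=> i ik; rewrite nth_mkseq //.
have [le|lt] := leqP k i.+1.
  by rewrite -(subnKC le) (pre k (i.+1 - k)%N).2.
by rewrite -{1}(subnKC (ltnW lt)) (pre i.+1 (k - i.+1)%N).2 // (leq_trans _ (sz _)).
Qed.

End System.

(** * Words over finite alphabets *)

Fixpoint words (T : eqType) (L : seq T) n : seq (seq T) :=
  if n is n'.+1 then [seq a :: w | a <- L, w <- words L n'] else [:: [::]].

Lemma mem_words (T : eqType) (L : seq T) n w :
  (w \in words L n) = (size w == n) && all [in L] w.
Proof.
elim: n w => [|n IH] [|a w] //=.
  by apply/negbTE/allpairsP => -[[b v] []].
rewrite eqSS andbCA -IH; apply/allpairsP/andP => [[[b v] /= [bL vw [-> ->]]]|[aL ww]].
  by [].
by exists (a, w).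
Qed.

Lemma words_uniq (T : eqType) (L : seq T) n : uniq L -> uniq (words L n).
Proof.
move=> uL; elim: n => //= n IH; apply: allpairs_uniq => //.
by move=> [a v] [b w] _ _ /= [-> ->].
Qed.

Lemma sum_wordsS (R : realType) (T : eqType) (L : seq T) n (F : seq T -> R) :
  \sum_(w <- words L n.+1) F w = \sum_(a <- L) \sum_(w <- words L n) F (a :: w).
Proof. exact: big_allpairs_dep. Qed.

Lemma sum_words_cat (R : realType) (T : eqType) (L : seq T) m n (F : seq T -> R) :
  \sum_(w <- words L (m + n)) F w =
  \sum_(u <- words L m) \sum_(v <- words L n) F (u ++ v).
Proof.
elim: m F => [|m IH] F; first by rewrite big_seq1.
by rewrite addSn !sum_wordsS; apply: eq_bigr => a _; rewrite IH.
Qed.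

Definition letters M : seq letter := [seq (n, j) | n <- iota 0 M, j <- enum 'I_4].

Lemma letters_uniq M : uniq (letters M).
Proof. by apply: allpairs_uniq; rewrite ?iota_uniq ?enum_uniq // => -[? ?] [? ?]. Qed.

Lemma mem_letters M a : (a \in letters M) = (a.1 < M)%N.
Proof.
apply/allpairsP/idP => [[[n j] /= [nM _ ->]]|aM]; first by rewrite mem_iota in nM.
by exists a; rewrite mem_iota mem_enum; split => //; case: a aM.
Qed.

(** The alphabets [letters M] exhaust all letters, so bounds uniform in [M] are bounds for the
    infinite system. *)
Lemma subset_letters (L : seq letter) : exists M, {subset L <= letters M}.
Proof.
exists (\max_(a <- L) a.1).+1 => a aL; rewrite mem_letters ltnS.
by rewrite (big_rem a) //= leq_maxl.
Qed.

Lemma letter_psum_bounded (R : realType) (s : R) : 1 < s -> exists2 C : R, 0 < C &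
  forall L : seq letter, uniq L -> \sum_(a <- L) a.1.+1%:R `^ (- s) <= C.
Proof.
move=> s1; have [C [C0 hC]] := psum_bounded s1.
exists (4 * C) => [|L uL]; first lra.
have [M LM] := subset_letters L.
apply: le_trans (ler_sum_subset uL LM _) _ => [a|]; first exact: powR_ge0.
rewrite big_allpairs /=.
under eq_bigr do rewrite big_enum /= sumr_const card_ord.
rewrite sumrMnl -[leLHS]mulr_natl ler_pM2l // (_ : iota 0 M = index_iota 0 M); last by rewrite /index_iota subn0.
by rewrite big_mkord.
Qed.

(** * Sums over words *)

Section Pressure.
Context {R : realType}.
Variables (phi : letter -> R[i] -> R[i]) (der : letter -> R[i] -> R).
Hypothesis S : conformal_system phi der.
Implicit Types (a b : letter) (u v w : seq letter) (z x y : R[i]) (t : R).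
Local Notation rho := (rho phi der).
Local Notation wder := (wder phi der).
Local Notation wmap := (wmap phi).

(* Sums over the infinite alphabet only appear through bounds that are uniform in
   the finite alphabet [L]. *)
Definition word_sum (L : seq letter) n t : R := \sum_(w <- words L n) rho w `^ t.

Lemma word_sum_ge0 L n t : 0 <= word_sum L n t.
Proof. by apply: sumr_ge0 => w _; apply: powR_ge0. Qed.

Lemma word_sum0 L t : word_sum L 0 t = 1.
Proof. by rewrite /word_sum big_seq1 powR1. Qed.

Lemma rho_powR_cat_le u v t : 0 <= t ->
  rho (u ++ v) `^ t <= 3 `^ t * rho u `^ t * rho v `^ t.
Proof.
move=> t0; have ru := rho_ge0 S u; have rv := rho_ge0 S v.
rewrite -!powRM ?mulr_ge0 //; apply: ge0_ler_powR; rewrite ?nnegrE ?mulr_ge0 ?(rho_ge0 S) //.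
exact: rho_cat_le.
Qed.

Lemma rho_powR_cat_ge u v t : 0 <= t ->
  rho u `^ t * rho v `^ t <= 3 `^ t * rho (u ++ v) `^ t.
Proof.
move=> t0; have ru := rho_ge0 S u; have rv := rho_ge0 S v.
rewrite -!powRM ?(rho_ge0 S) //; apply: ge0_ler_powR; rewrite ?nnegrE ?mulr_ge0 ?(rho_ge0 S) //.
exact: rho_cat_ge.
Qed.

Lemma word_sum_submul L m n t : 0 <= t -> word_sum L (m + n) t <= 3 `^ t * word_sum L m t * word_sum L n t.
Proof.
move=> t0; rewrite /word_sum sum_words_cat -mulrA mulr_suml mulr_sumr; apply: ler_sum => u _.
by rewrite !mulr_sumr; apply: ler_sum => v _; rewrite mulrA; apply: rho_powR_cat_le.
Qed.

Lemma word_sum_mul_le L m t (c : R) k : 0 <= t -> 3 `^ t * word_sum L m t <= c ->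
  word_sum L (k * m) t <= c ^+ k.
Proof.
move=> t0 h; elim: k => [|k IH]; first by rewrite mul0n word_sum0.
rewrite mulSn exprS; apply: le_trans (word_sum_submul _ _ _ t0) _.
apply: ler_pM => //; first by rewrite mulr_ge0 ?powR_ge0 ?word_sum_ge0.
exact: word_sum_ge0.
Qed.

(** The outermost letter is summed first, at the base point [wmap w z], which stays in the disk of
    radius 1/16. A one-letter bound uniform in the base point thus becomes a power, without any
    distortion constant. *)
Lemma sum_wder_le L t (q : R) n z :
  (forall x, nm x <= 1/16 -> \sum_(a <- L) der a x `^ t <= q) ->
  nm z <= 1/16 -> \sum_(w <- words L n) wder w z `^ t <= q ^+ n.
Proof.
move=> hq z1; have z2 : nm z <= 1 by lra.
elim: n => [|n IH]; first by rewrite big_seq1 /= powR1.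
rewrite sum_wordsS exchange_big /= exprS.
have q0 : 0 <= q by apply: le_trans (hq _ z1); apply: sumr_ge0 => a _; apply: powR_ge0.
apply: le_trans (ler_wpM2l q0 IH); rewrite mulr_sumr; apply: ler_sum => w _.
have wz : nm (wmap w z) <= 1 by apply: (wmap_le1 S).
under eq_bigr do rewrite powRM ?(ltW (cs_der_gt0 S _ wz)) ?(ltW (wder_gt0 S _ z2)) //.
by rewrite -mulr_suml ler_wpM2r ?powR_ge0 // hq // (wmap_small S).
Qed.

Lemma sum_wder_ge L t (q : R) n z : 0 <= q ->
  (forall x, nm x <= 1/16 -> q <= \sum_(a <- L) der a x `^ t) ->
  nm z <= 1/16 -> q ^+ n <= \sum_(w <- words L n) wder w z `^ t.
Proof.
move=> q0 hq z1; have z2 : nm z <= 1 by lra.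
elim: n => [|n IH]; first by rewrite big_seq1 /= powR1.
rewrite sum_wordsS exchange_big /= exprS.
apply: le_trans (ler_wpM2l q0 IH) _; rewrite mulr_sumr; apply: ler_sum => w _.
have wz : nm (wmap w z) <= 1 by apply: (wmap_le1 S).
under eq_bigr do rewrite powRM ?(ltW (cs_der_gt0 S _ wz)) ?(ltW (wder_gt0 S _ z2)) //.
by rewrite -mulr_suml ler_wpM2r ?powR_ge0 // hq // (wmap_small S).
Qed.

Lemma nm0_small : nm (0 : R[i]) <= 1/16.
Proof. by rewrite nm0; lra. Qed.

Lemma word_sum_le L t (q : R) n :
  (forall x, nm x <= 1/16 -> \sum_(a <- L) der a x `^ t <= q) -> word_sum L n t <= q ^+ n.
Proof. move=> h; exact: (sum_wder_le n h nm0_small). Qed.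

Lemma word_sum_ge L t (q : R) n : 0 <= q ->
  (forall x, nm x <= 1/16 -> q <= \sum_(a <- L) der a x `^ t) -> q ^+ n <= word_sum L n t.
Proof. move=> q0 h; exact: (sum_wder_ge n q0 h nm0_small). Qed.

Lemma der_powR_decay a z t : 0 <= t <= 1 -> nm z <= 1 ->
  der a z `^ t <= 2 * a.1.+1%:R `^ (- (6 * t)).
Proof.
move=> /andP[t0 t1] z1.
have N0 : 0 < a.1.+1%:R :> R by rewrite ltr0n.
have -> : 2 * a.1.+1%:R `^ (- (6 * t)) = 2 * (a.1.+1%:R ^+ 6)^-1 `^ t :> R.
  by rewrite -powR_invn ?ltW // -powRrM mulNr.
apply: le_trans (_ : (2 * (a.1.+1%:R ^+ 6)^-1) `^ t <= _).
  apply: ge0_ler_powR; rewrite ?nnegrE ?mulr_ge0 ?invr_ge0 ?exprn_ge0 ?(ltW N0) //.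
    exact/ltW/(cs_der_gt0 S).
  exact: (cs_der_decay S).
rewrite powRM ?invr_ge0 ?exprn_ge0 ?(ltW N0) // ler_wpM2r ?powR_ge0 //.
by apply: ler1_powR => //; lra.
Qed.

(** Derivatives decay like [n ^ -6], so the exponent 1/4 still gives a convergent series. It is the
    lower endpoint of the interpolation in [hdim_lt_word_sum]. *)
Lemma sum_der_quarter : exists2 B : R, 0 < B & forall L z, uniq L -> nm z <= 1 ->
  \sum_(a <- L) der a z `^ (1/4) <= B.
Proof.
have [|C C0 hC] := @letter_psum_bounded R (6 * (1/4)); first lra.
exists (2 * C) => [|L z uL z1]; first lra.
apply: le_trans (_ : \sum_(a <- L) 2 * a.1.+1%:R `^ (- (6 * (1/4))) <= _).
  by apply: ler_sum => a _; apply: der_powR_decay => //; lra.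
by rewrite -mulr_sumr ler_pM2l // hC.
Qed.

End Pressure.

(** * Bounds for the Hausdorff measure *)

Section Measures.
Context {R : realType}.
Implicit Types (U A : set R[i]) (t d : R).

Lemma diam_ge0 U z : U z -> (0 <= diam U)%E.
Proof.
move=> Uz; apply: ereal_sup_ubound; exists z => //; exists z => //.
by rewrite cdistE subrr nm0.
Qed.

Lemma diam_le U d : (forall z x, U z -> U x -> nm (z - x) <= d) -> (diam U <= d%:E)%E.
Proof.
move=> h; apply: ge_ereal_sup => _ [z Uz [x Ux <-]].
by rewrite lee_fin cdistE h.
Qed.

Lemma diam_pow_ge0 t U : (0 <= diam_pow t U)%E.
Proof. by rewrite /diam_pow; case: ifP => // _; apply: poweR_ge0. Qed.

Lemma diam_pow_le t U d : 0 <= t -> 0 <= d ->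
  (forall z x, U z -> U x -> nm (z - x) <= d) -> (diam_pow t U <= (d `^ t)%:E)%E.
Proof.
move=> t0 d0 h; rewrite /diam_pow; case: ifPn => [_|/set0P[z Uz]].
  by rewrite lee_fin powR_ge0.
rewrite -poweR_EFin; apply: gt0_ler_poweR => //; rewrite ?in_itv /= ?andbT ?leey ?lee_fin //.
- by rewrite (diam_ge0 Uz).
- by rewrite d0.
- exact: diam_le.
Qed.

Lemma nneseries_le (u : nat -> \bar R) (C : \bar R) : (forall k, 0 <= u k)%E ->
  (forall m, \sum_(0 <= k < m) u k <= C)%E -> (\sum_(0 <= k <oo) u k <= C)%E.
Proof.
move=> u0 h; apply: lime_le; first by apply: is_cvg_nneseries => n _ _; exact: u0.
exact: nearW.
Qed.

Lemma ereal_le_eps (x : \bar R) : (forall e : R, 0 < e -> (x <= e%:E)%E) -> (x <= 0)%E.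
Proof.
move=> h; apply/lee_addgt0Pr => e e0; rewrite add0e; exact: h.
Qed.

Lemma hausdorff_pre_ge0 t d A : (0 <= hausdorff_pre t d A)%E.
Proof.
apply: le_ereal_inf_tmp => _ [U _ <-].
by apply: nneseries_ge0 => k _ _; apply: diam_pow_ge0.
Qed.

Lemma hausdorff_measure_ge0 t A : (0 <= hausdorff_measure t A)%E.
Proof.
apply: le_trans (hausdorff_pre_ge0 t 1 A) _.
by apply: ereal_sup_ubound; exists 1 => //=.
Qed.

Lemma sum_oapp_pmap (T T' : Type) (h : T -> option T') (f : T' -> R) (l : seq T) :
  \sum_(k <- l) oapp f 0 (h k) = \sum_(w <- pmap h l) f w.
Proof.
elim: l => [|k l IH] /=; first by rewrite !big_nil.
by rewrite big_cons IH; case: (h k) => [w|] /=; rewrite ?big_cons ?add0r.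
Qed.

End Measures.

(** * Upper bound: covering by cylinders *)

Section UpperBound.
Context {R : realType}.
Variables (phi : letter -> R[i] -> R[i]) (der : letter -> R[i] -> R).
Hypothesis S : conformal_system phi der.
Implicit Types (a b : letter) (u v w : seq letter) (z x y : R[i]) (t : R).
Local Notation rho := (rho phi der).
Local Notation wmap := (wmap phi).
Local Notation word_sum := (word_sum phi der).
Local Notation J := (limit_set phi closed_disk).

Lemma wmap_diam w z x : nm z <= 1 -> nm x <= 1 -> nm (wmap w z - wmap w x) <= 6 * rho w.
Proof.
move=> z1 x1; apply: le_trans (wmap_dist_le S w z1 x1) _.
have : nm (z - x) <= 2 by have := ler_nmD z (- x); rewrite nmN; lra.
have := rho_gt0 S w; nra.
Qed.

(** Covers are indexed by [nat], so words are enumerated by [pickle]; an index that codes no word of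
    length [n] gets the empty set, which has weight 0. *)
Let cyl (n k : nat) : set R[i] :=
  if @pickle_inv (seq letter) k is Some w then
    if size w == n then wmap w @` [set z | nm z <= 1] else set0
  else set0.

Lemma hausdorff_measure_eq0 t : 0 < t ->
  (forall e, 0 < e -> forall n0, exists2 n, (n0 <= n)%N &
    forall M, word_sum (letters M) n t <= e) ->
  hausdorff_measure t J = 0%E.
Proof.
move=> t0 hZ; apply/eqP; rewrite eq_le hausdorff_measure_ge0 andbT.
apply: ge_ereal_sup => _ [d /= d0 <-]; apply: ereal_le_eps => e e0.
have e6 : 0 < e / 6 `^ t by rewrite divr_gt0 ?powR_gt0.
have [|||n0 hn0] := @geom_small R 6 (1/4) d => //; first lra.
have [n nn hn] := hZ _ e6 n0.
have d6 w : size w = n -> 6 * rho w <= d.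
  move=> sw; have := rho_le S w; rewrite sw => h; apply: ltW.
  by apply: le_lt_trans (hn0 n nn); rewrite ler_pM2l.
apply: ge_ereal_inf.
exists (\sum_(0 <= k <oo) diam_pow t (cyl n k))%E; first exists (cyl n) => //.
  split.
    rewrite (limit_setE S) => _ [s _ <-]; exists (pickle (mkseq s n)) => //.
    rewrite /cyl pickleK_inv size_mkseq eqxx.
    by exists (code S (shift n s)); rewrite /= ?code_le1 // -code_shift.
  move=> k; apply: diam_le; rewrite /cyl; case: pickle_inv => [w|//].
  case: eqP => [sw|//] _ _ [z z1 <-] [x x1 <-].
  exact: le_trans (wmap_diam w z1 x1) (d6 _ sw).
apply: nneseries_le => [k|m]; first exact: diam_pow_ge0.
pose f w : R := if size w == n then (6 * rho w) `^ t else 0.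
apply: (@le_trans _ _ (\sum_(0 <= k < m) (oapp f 0 (pickle_inv k))%:E)%E).
  apply: lee_sum => k _; rewrite /cyl; case: pickle_inv => [w|] /=; last first.
    by rewrite /diam_pow eqxx.
  rewrite /f; case: eqP => [sw|_]; last by rewrite /diam_pow eqxx.
  apply: diam_pow_le; rewrite ?mulr_ge0 ?(rho_ge0 S) ?ltW //.
  by move=> _ _ [z z1 <-] [x x1 <-]; apply: wmap_diam.
rewrite sumEFin lee_fin sum_oapp_pmap /f -big_mkcond -big_filter.
set W := [seq _ <- _ | _].
have uW : uniq W.
  by rewrite filter_uniq // (pmap_uniq (@pickle_invK _)) // /index_iota iota_uniq.
(* A partial sum involves finitely many words, hence one finite alphabet, to which the uniform bound
   [hn] applies. *)
have [M hM] := subset_letters (flatten W).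
have sW : {subset W <= words (letters M) n}.
  move=> w wW; rewrite mem_words; have := wW; rewrite mem_filter => /andP[-> _] /=.
  by apply/allP => a aw; apply: hM; apply/flattenP; exists w.
apply: le_trans (ler_sum_subset uW sW _) _ => [w|]; first exact: powR_ge0.
under eq_bigr do rewrite powRM ?(rho_ge0 S) //.
rewrite -mulr_sumr mulrC -ler_pdivlMr ?powR_gt0 //; exact: hn.
Qed.

End UpperBound.

(** * Dependent choice and prefix combinatorics *)

Lemma invariant_path (X : Type) (I : X -> Prop) (Q : X -> X -> Prop) x0 : I x0 ->
  (forall x, I x -> exists y, Q x y /\ I y) ->
  exists f : nat -> X, f 0%N = x0 /\ forall k, I (f k) /\ Q (f k) (f k.+1).
Proof.
move=> I0 h.
pose step x := if pselect (exists y, Q x y /\ I y) is left e then projT1 (cid e) else x.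
have hs x : I x -> Q x (step x) /\ I (step x).
  move=> Ix; rewrite /step; case: pselect => [e|/(_ (h x Ix))//].
  exact: (projT2 (cid e)).
exists (fun k => iter k step x0); split => // k.
have Ik : I (iter k step x0) by elim: k => //= k /hs[].
by split => //=; have [] := hs _ Ik.
Qed.

(** Incomparable words share a prefix [p] and then branch; the gap condition at the letters [a] and
    [b] separates their cylinders. *)
Lemma prefix_split (T : eqType) (u v : seq T) : ~~ prefix u v -> ~~ prefix v u ->
  exists p a b u' v', [/\ a != b, u = p ++ a :: u' & v = p ++ b :: v'].
Proof.
elim: u v => [|a u IH] [|b v] //=.
have [->|ab] := eqVneq a b; last by move=> _ _; exists [::], a, b, u, v.
rewrite ?eqxx /= => nuv nvu; have [p [c [d [u' [v' [cd -> ->]]]]]] := IH _ nuv nvu.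
by exists (b :: p), c, d, u', v'.
Qed.

Lemma prefix_size_eq (T : eqType) (u v : seq T) : size u = size v -> prefix u v -> u = v.
Proof. by move=> e; rewrite prefixE e take_size => /eqP. Qed.

Lemma uniform_radius (R : realType) (T : eqType) (s : seq T) (P : T -> R -> Prop) :
  (forall x d d', P x d -> d' <= d -> P x d') ->
  (forall x, x \in s -> exists2 d, 0 < d & P x d) ->
  exists2 d, 0 < d & forall x, x \in s -> P x d.
Proof.
move=> mono; elim: s => [|y s IH] h; first by exists 1.
have [x xs|d d0 hd] := IH; first by apply: h; rewrite inE xs orbT.
have [d' d'0 hd'] := h y (mem_head _ _).
exists (Num.min d d') => [|x]; first by rewrite lt_min d0.
rewrite inE => /orP[/eqP ->|xs]; [apply: (mono _ _ _ hd')|apply: (mono _ _ _ (hd _ xs))].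
  by rewrite ge_min lexx orbT.
by rewrite ge_min lexx.
Qed.

Lemma sum_at_most_one (R : realType) (T : eqType) (s : seq T) (P : pred T) (e : R) :
  uniq s -> 0 <= e -> {in s &, forall x y, P x -> P y -> x = y} ->
  \sum_(x <- s) (if P x then e else 0) <= e.
Proof.
move=> us e0 h; have [/hasP[x xs Px]|/hasPn hn] := boolP (has P s).
  rewrite (bigD1_seq x) //= Px big1_seq ?addr0 // => y /andP[yx ys].
  by case: ifP => // Py; rewrite (h _ _ ys xs Py Px) eqxx in yx.
by rewrite big1_seq // => x /andP[_ xs]; rewrite (negbTE (hn x xs)).
Qed.

(** * Lower bound: a code that escapes a cheap cover *)

Section LowerBound.
Context {R : realType}.
Variables (phi : letter -> R[i] -> R[i]) (der : letter -> R[i] -> R).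
Hypothesis S : conformal_system phi der.
Implicit Types (a b : letter) (u v w : seq letter) (z x y : R[i]) (t : R).
Local Notation rho := (rho phi der).
Local Notation wmap := (wmap phi).
Local Notation word_sum := (word_sum phi der).
Local Notation J := (limit_set phi closed_disk).

Lemma small_le1 z : nm z <= 1/16 -> nm z <= 1.
Proof. by move=> z1; lra. Qed.

(** The gap at the branching letters is scaled by the lower Lipschitz constant of the common prefix;
    there are finitely many pairs, so a minimum exists. *)
Lemma words_separated L n : exists2 d, 0 < d & forall u v, u \in words L n ->
  v \in words L n -> u != v -> forall z x, nm z <= 1/16 -> nm x <= 1/16 ->
  d <= nm (wmap u z - wmap v x).
Proof.
have [c c0 gap] := cs_gap S.
pose P (p : seq letter * seq letter) d := p.1 != p.2 -> forall z x,
  nm z <= 1/16 -> nm x <= 1/16 -> d <= nm (wmap p.1 z - wmap p.2 x).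
have [||d d0 hd] := @uniform_radius R _ [seq (u, v) | u <- words L n, v <- words L n] P.
- by move=> p d d' h dd ne z x z1 x1; apply: le_trans dd _; apply: h.
- move=> p /allpairsP[[u v] /= [uW vW ->]].
  have [->|uv] := eqVneq u v; first by exists 1 => //; rewrite /P eqxx.
  have suv : size u = size v.
    by move: uW vW; rewrite !mem_words => /andP[/eqP -> _] /andP[/eqP -> _].
  have [|| q [a [b [u' [v' [ab eu ev]]]]]] := @prefix_split _ u v.
  + by apply: contra uv => /(prefix_size_eq suv) ->.
  + by apply: contra uv => /(prefix_size_eq (esym suv)) ->.
  exists (rho q / 3 * (c / a.1.+1%:R ^+ 4)).
    by rewrite !mulr_gt0 ?invr_gt0 ?exprn_gt0 ?(rho_gt0 S) ?ltr0n.
  move=> _ z x z1 x1; rewrite /= eu ev !wmap_cat.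
  have z2 := wmap_small S (a :: u') z1; have x2 := wmap_small S (b :: v') x1.
  apply: le_trans (wmap_dist_ge S q (small_le1 z2) (small_le1 x2)).
  by rewrite ler_wpM2l ?divr_ge0 ?(rho_ge0 S) //= gap // (wmap_small S).
exists d => // u v uW vW uv z x z1 x1.
by apply: (hd (u, v)) => //; apply/allpairsP; exists (u, v).
Qed.

(** By [wmap_dist_ge], [rho w / 3] is a lower Lipschitz constant, so the hypothesis says that the
    shares of the children add up to at least the share of the parent. Against a cover of small
    total weight some child therefore always stays below its share. The code obtained in the limit
    lies in a member of the cover, whose positive weight would be below arbitrarily small shares. *)
Lemma hausdorff_measure_neq0 L n t : uniq L -> 0 < t ->
  1 <= \sum_(w <- words L n) (rho w / 3) `^ t ->
  forall t', 0 <= t' <= t -> hausdorff_measure t' J <> 0%E.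
Proof.
move=> uL t0 hsum t' /andP[t'0 t't] H0.
(* The empty word alone gives [(1/3) ^ t < 1]. *)
have n0 : (0 < n)%N.
  case: n hsum => // ; rewrite big_seq1 /rho /= => h.
  have : ((1/3 : R) `^ t < 1 `^ t).
    by apply: gt0_ltr_powR; rewrite ?nnegrE //; lra.
  by rewrite powR1; move: h; lra.
have [D D0 hD] := words_separated L n.
have Dt : 0 < D `^ t by apply: powR_gt0.
have pre0 : hausdorff_pre t' 1 J = 0%E.
  apply/eqP; rewrite eq_le hausdorff_pre_ge0 andbT -H0.
  by apply: ereal_sup_ubound; exists 1 => /=.
have : (hausdorff_pre t' 1 J < (D `^ t / 4)%:E)%E by rewrite pre0 lte_fin; lra.
move=> /ereal_inf_lt[_ [U [Ucov Udiam] <-] hU].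
pose A k := diam_pow t (U k).
have A0 k : (0 <= A k)%E by apply: diam_pow_ge0.
have AA k : (A k <= diam_pow t' (U k))%E.
  rewrite /A /diam_pow; case: ifPn => // /set0P[z Uz].
  have := diam_ge0 Uz; have := Udiam k; case: (diam (U k)) => // r.
  rewrite !lee_fin => r1 r0.
  (* Since [t > 0], a member of diameter 0 has weight 0 at [t]; the exponent [t'] may be 0. *)
  have [->|rn] := eqVneq r 0; first by rewrite powR0 ?gt_eqF ?powR_ge0.
  by apply: ger_powR => //; rewrite r1 andbT lt0r rn.
have Afin k : A k \is a fin_num.
  rewrite ge0_fin_numE // /A /diam_pow; case: ifP => // _.
  by apply: poweR_lty; apply: le_lt_trans (Udiam k) _; rewrite ltry.
(* The weights are enlarged by a geometric series of total at most [D ^ t / 4], so that empty and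
   one-point members also get a positive weight, strictly above their [t]-th power of the
   diameter. *)
pose e k : R := fine (A k) + (D `^ t / 4) / (2 ^ k.+1)%:R.
have ee k : (A k + ((D `^ t / 4) / (2 ^ k.+1)%:R)%:E)%E = (e k)%:E.
  by rewrite /e EFinD fineK.
have e0 k : 0 < e k.
  rewrite /e ltr_wpDl ?fine_ge0 // divr_gt0 // ?ltr0n ?expn_gt0 //; lra.
have eA k : (A k < (e k)%:E)%E.
  rewrite -ee lteDl ?Afin // lte_fin divr_gt0 // ?ltr0n ?expn_gt0 //; lra.
have sume : (\sum_(0 <= k <oo) (e k)%:E < (D `^ t)%:E)%E.
  rewrite (eq_eseriesr (fun k _ => esym (ee k))).
  apply: le_lt_trans (epsilon_trick _ A0 _) _; first lra.
  apply: (@le_lt_trans _ _ ((D `^ t / 4)%:E + (D `^ t / 4)%:E)%E).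
    rewrite leeD2r //; apply: ltW; apply: le_lt_trans hU.
    by apply: lee_nneseries => k *; rewrite ?A0 ?AA.
  by rewrite -EFinD lte_fin; lra.
pose C u := wmap u @` [set z | nm z <= 1/16].
pose meet u k := `[< U k `&` C u !=set0 >].
pose load u := (\sum_(0 <= k <oo) (if meet u k then e k else 0)%:E)%E.
have load_ge u k : meet u k -> ((e k)%:E <= load u)%E.
  move=> m; apply: (@le_trans _ _ (\sum_(0 <= i < k.+1) (if meet u i then e i else 0)%:E)%E).
    rewrite big_nat_recr //= m leeDr // sume_ge0 // => i _.
    by rewrite lee_fin; case: ifP => // _; exact/ltW.
  by apply: nneseries_lim_ge => i _ _; rewrite lee_fin; case: ifP => // _; exact/ltW.
(* A state is a word with a lower Lipschitz constant [c] of its map; the cover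
   members meeting its cylinder have total weight below [(c * D) ^ t], so each
   of them meets at most one child cylinder. *)
pose I (p : seq letter * R) := [/\ 0 < p.2,
  forall z x, nm z <= 1 -> nm x <= 1 -> p.2 * nm (z - x) <= nm (wmap p.1 z - wmap p.1 x) &
  (load p.1 < ((p.2 * D) `^ t)%:E)%E].
pose Q (p q : seq letter * R) := exists2 w, w \in words L n &
  q = (p.1 ++ w, p.2 * (rho w / 3)).
have [||f [f0 hf]] := @invariant_path _ I Q ([::], 1).
- split => //=; first by move=> z x _ _; rewrite mul1r.
  rewrite mul1r; apply: le_lt_trans sume; apply: lee_nneseries => k *; rewrite lee_fin.
    by case: ifP => // _; exact/ltW.
  by case: ifP => // _; exact/ltW.
- move=> [u c] [/= c0 lip inv]; apply: contrapT => hno.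
  have hw w : w \in words L n ->
      ((((c * D) `^ t) * (rho w / 3) `^ t)%:E <= load (u ++ w))%E.
    move=> wW; rewrite leNgt; apply/negP => hlt; apply: hno.
    exists (u ++ w, c * (rho w / 3)); split; first by exists w.
    split => /=; first by rewrite !mulr_gt0 ?(rho_gt0 S).
      move=> z x z1 x1; rewrite !wmap_cat -mulrA.
      apply: le_trans (lip _ _ (wmap_le1 S w z1) (wmap_le1 S w x1)).
      by rewrite ler_pM2l // wmap_dist_ge.
    rewrite mulrAC powRM ?mulr_ge0 ?(ltW c0) ?(ltW D0) ?divr_ge0 ?(rho_ge0 S) //.
  have sub w k : meet (u ++ w) k -> meet u k.
    move=> /asboolP[y [Uy [z z1 yz]]]; apply/asboolP; exists y; split=> //.
    by exists (wmap w z); [exact: (wmap_small S)|rewrite -wmap_cat].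
  have : (\sum_(w <- words L n) load (u ++ w) <= load u)%E.
    rewrite /load -nneseries_sum; last first.
      by move=> w k _; rewrite lee_fin; case: ifP => // _; exact/ltW.
    apply: lee_nneseries => [k _ _|k _].
      by apply: sume_ge0 => w _; rewrite lee_fin; case: ifP => // _; exact/ltW.
    rewrite sumEFin lee_fin; case: ifPn => [mu|nmu]; last first.
      by rewrite big1 // => w _; rewrite ifN //; apply: contra nmu; exact: sub.
    apply: sum_at_most_one; [exact: words_uniq|exact/ltW|].
    move=> w w' wW w'W /asboolP[y [Uy [z z1 yz]]] /asboolP[y' [Uy' [z' z'1 yz']]].
    apply/eqP; apply: contrapT => /negP ww'.
    have hd : c * D <= nm (y - y').
      rewrite -yz -yz' !wmap_cat.
      apply: le_trans (lip _ _ (small_le1 (wmap_small S w z1)) (small_le1 (wmap_small S w' z'1))).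
      by rewrite ler_pM2l // hD.
    (* A member meeting two children has diameter at least [c * D], so its weight exceeds
       [(c * D) ^ t], which exceeds the load of [u]; but that load includes this weight. *)
    have : ((e k)%:E < (e k)%:E)%E.
      apply: le_lt_trans (load_ge _ _ mu) _; apply: lt_trans inv _.
      apply: le_lt_trans (eA k).
      rewrite /A /diam_pow ifF; last by apply/negbTE/set0P; exists y.
      rewrite -poweR_EFin; apply: gt0_ler_poweR; rewrite ?(ltW t0) //.
      - by rewrite in_itv /= leey andbT lee_fin mulr_ge0 ?ltW.
      - by rewrite in_itv /= leey andbT (diam_ge0 Uy).
      apply: le_trans (_ : (nm (y - y'))%:E <= _)%E; first by rewrite lee_fin.
      by apply: ereal_sup_ubound; exists y => //; exists y'.
    by rewrite ltxx.
  move=> hh; suff : (((c * D) `^ t)%:E <= load u)%E by rewrite leNgt inv.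
  apply: le_trans hh; apply: (@le_trans _ _ (\sum_(w <- words L n) ((c * D) `^ t * (rho w / 3) `^ t)%:E)%E).
    rewrite sumEFin lee_fin -mulr_sumr ler_peMr // powR_ge0 //.
  rewrite big_seq [leRHS]big_seq; exact: lee_sum.
have [s hs] : exists s, forall k, (f k).1 = mkseq s (size (f k).1) /\ (k <= size (f k).1)%N.
  apply: chain_limit => k; have [_ [w wW ->]] := hf k; exists w => //.
  by move: wW; rewrite mem_words => /andP[/eqP sw _]; rewrite -size_eq0 sw -lt0n.
have fk k : (f k).2 <= (1/3) ^+ k.
  elim: k => [|k IH]; first by rewrite f0.
  have [[c0 _ _] [w wW ->]] := hf k; rewrite exprS mulrC /=.
  apply: ler_pM => //; [by rewrite divr_ge0 ?(rho_ge0 S)|exact: ltW c0|].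
  by rewrite ler_pM2r ?invr_gt0 // (rho_le1 S).
have : J (code S s) by rewrite (limit_setE S); exists s.
move=> /Ucov[k _ Uk].
have hk m : e k < ((f m).2 * D) `^ t.
  have [[c0 _ inv] _] := hf m; rewrite -lte_fin; apply: le_lt_trans inv.
  apply: load_ge; apply/asboolP; exists (code S s); split => //.
  have [e1 _] := hs m; rewrite e1.
  by exists (code S (shift (size (f m).1) s)); rewrite /= ?code_small // -code_shift.
have [||| m hm] := @geom_small R D (1/3) (e k `^ t^-1); [exact: ltW|lra|exact: powR_gt0|].
have := hk m; rewrite ltNge => /negP; apply.
rewrite -[leRHS](@powRr1 R) ?(ltW (e0 k)) // -(mulVf (lt0r_neq0 t0)) powRrM.
have [[c0 _ _] _] := hf m.
apply: ge0_ler_powR; rewrite ?nnegrE ?powR_ge0 ?mulr_ge0 ?(ltW c0) ?(ltW D0) ?(ltW t0) //.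
apply: ltW; apply: le_lt_trans (hm m (leqnn _)).
by rewrite mulrC ler_pM2l.
Qed.

End LowerBound.

(** * The Hausdorff dimension in terms of word sums *)

Section Dimension.
Context {R : realType}.
Variables (phi : letter -> R[i] -> R[i]) (der : letter -> R[i] -> R).
Hypothesis S : conformal_system phi der.
Implicit Types (a b : letter) (u v w : seq letter) (z x y : R[i]) (t : R).
Local Notation rho := (rho phi der).
Local Notation wmap := (wmap phi).
Local Notation word_sum := (word_sum phi der).
Local Notation J := (limit_set phi closed_disk).

Lemma powR3_le t : 0 <= t <= 1 -> (3 : R) `^ t <= 3.
Proof. by move=> /andP[_ t1]; apply: ler1_powR => //; lra. Qed.

Lemma hausdorff_measure_half : hausdorff_measure (1/2) J = 0%E.
Proof.
have [q q1 hq] := cs_sum_lt1 S.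
apply: (hausdorff_measure_eq0 S); first lra.
move=> e e0 n0.
have q0 : 0 <= q by have := hq [::] 0 isT (@nm0_small R); rewrite big_nil.
have [|| |m hm] := @geom_small R 1 q e => //; first by rewrite q0.
exists (maxn n0 m); first exact: leq_maxl.
move=> M; apply: ltW; apply: le_lt_trans (hm _ (leq_maxr n0 m)); rewrite [leRHS]mul1r.
by apply: (word_sum_le S) => x x1; apply: hq => //; exact: letters_uniq.
Qed.

Definition hdim : R := fine (hausdorff_dim J).

Lemma hausdorff_dim_fin : hausdorff_dim J \is a fin_num.
Proof.
rewrite fin_numE; apply/andP; split.
  rewrite -ltNye; apply: (@lt_le_trans _ _ 0%E); first exact: ltNyr.
  by apply: le_ereal_inf_tmp => _ [t [t0 _] <-]; rewrite lee_fin.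
rewrite -ltey; apply: (@le_lt_trans _ _ (1/2)%:E); last exact: ltry.
apply: ereal_inf_lbound; exists (1/2) => //=; split; last exact: hausdorff_measure_half.
by lra.
Qed.

Lemma hdimE : hausdorff_dim J = hdim%:E.
Proof. by rewrite /hdim fineK // hausdorff_dim_fin. Qed.

Lemma hdim_le t : 0 <= t -> hausdorff_measure t J = 0%E -> hdim <= t.
Proof.
by move=> t0 Ht; rewrite -lee_fin -hdimE; apply: ereal_inf_lbound; exists t.
Qed.

Lemma hdim_ge t : (forall s, 0 <= s -> hausdorff_measure s J = 0%E -> t <= s) -> t <= hdim.
Proof.
move=> h; rewrite -lee_fin -hdimE; apply: le_ereal_inf_tmp => _ [s [s0 Hs] <-].
by rewrite lee_fin h.
Qed.

Lemma hdim_le_half : hdim <= 1/2.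
Proof. by apply: hdim_le hausdorff_measure_half; lra. Qed.

(** The threshold 9 is [3 ^ 2], which absorbs the factor [3 ^ t] coming from [(rho w / 3) ^ t]. *)
Lemma hdim_ge_word_sum L n t : uniq L -> 0 < t <= 2 -> 9 <= word_sum L n t -> t <= hdim.
Proof.
move=> uL /andP[t0 t2] h; apply: hdim_ge => s s0 Hs; rewrite leNgt; apply/negP => st.
apply: (hausdorff_measure_neq0 S uL t0 (n := n) _ _ Hs); last by rewrite s0 ltW.
under eq_bigr do rewrite powRM ?(rho_ge0 S) ?invr_ge0 //.
rewrite -mulr_suml -powR_inv1 // powRAC powR_inv1 ?powR_ge0 //.
rewrite ler_pdivlMr ?powR_gt0 // mul1r; apply: le_trans h.
have -> : 9 = 3 `^ 2 :> R by rewrite powR_mulrn //; lra.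
by apply: ler_powR => //; lra.
Qed.

(** A sum over finitely many words is continuous in the exponent, so the strict inequality survives
    at some [s > t]. *)
Lemma hdim_gt_word_sum L n t : uniq L -> 0 < t <= 1 -> 9 < word_sum L n t -> t < hdim.
Proof.
move=> uL /andP[t0 t1] /sum_powR_right[w|s /andP[ts s1] hs].
  by rewrite (rho_gt0 S) (rho_le1 S).
apply: (lt_le_trans ts); apply: (hdim_ge_word_sum uL _ (ltW hs)); lra.
Qed.

Lemma hdim_ge_sum L t (lam : R) : uniq L -> 0 < t <= 1 -> 1 < lam ->
  (forall x, nm x <= 1/16 -> lam <= \sum_(a <- L) der a x `^ t) -> t <= hdim.
Proof.
move=> uL t01 lam1 h; apply: ltW.
have [|||m hm] := @geom_small R 9 lam^-1 1 => //.
  have lam0 := lt_trans ltr01 lam1.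
  by rewrite invr_ge0 invf_lt1 // lam1 andbT ltW.
apply: (@hdim_gt_word_sum L m) => //; apply: (@lt_le_trans _ _ (lam ^+ m)); last first.
  by apply: (word_sum_ge S) => //; apply/ltW/(lt_trans _ lam1).
have := hm m (leqnn _); rewrite exprVn ltr_pdivrMr ?mul1r // exprn_gt0 //.
exact: lt_trans lam1.
Qed.

Lemma hdim_ge_third : 1/3 <= hdim.
Proof.
have [L [lam [uL [lam1 h]]]] := cs_sum_gt1 S.
by apply: (hdim_ge_sum uL _ lam1 h); lra.
Qed.

Lemma hdim_gt0 : 0 < hdim.
Proof. by have := hdim_ge_third; lra. Qed.

Lemma word_sum_hdim_le L n : uniq L -> word_sum L n hdim <= 9.
Proof.
move=> uL; rewrite leNgt; apply/negP => h.
suff : hdim < hdim by rewrite ltxx.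
apply: hdim_gt_word_sum uL _ h; have := hdim_gt0; have := hdim_le_half; lra.
Qed.

(** Over the infinite alphabet continuity to the left of [t] needs a uniform bound: interpolating
    with the exponent 1/4, where sums are at most [B ^ n], keeps [3 * c' < 1] at some [s < t].
    Submultiplicativity then sends the sums over longer words to 0, so the measure at [s]
    vanishes. *)
Lemma hdim_lt_word_sum n t (c : R) : 1/4 < t <= 1 -> 3 * c < 1 ->
  (forall M, word_sum (letters M) n t <= c) -> hdim < t.
Proof.
move=> /andP[t4 t1] c3 hc.
have [B B0 hB] := sum_der_quarter S.
have c0 : 0 <= c := le_trans (word_sum_ge0 _ _ _ _ _) (hc 0%N).
have B1 M : word_sum (letters M) n (1/4) <= B ^+ n.
  by apply: (word_sum_le S) => x x1; apply: hB; [exact: letters_uniq|lra].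
have Bn : 0 < B ^+ n by apply: exprn_gt0.
(* With this weight the contribution [p * B ^ n] of the exponent 1/4 uses at most half of the slack
   [1/3 - c]. *)
pose p := Num.min 1 ((1/3 - c) / (2 * B ^+ n)).
have p0 : 0 < p.
  by rewrite lt_min ltr01 /=; apply: divr_gt0; [lra|apply: mulr_gt0].
have p1 : p <= 1 by rewrite ge_min lexx.
have pB : p * B ^+ n <= (1/3 - c) / 2.
  have : p <= (1/3 - c) / (2 * B ^+ n) by rewrite ge_min lexx orbT.
  rewrite ler_pdivlMr ?mulr_gt0 //; lra.
pose s := p * (1/4) + (1 - p) * t.
have st : s < t by rewrite /s; nra.
have s0 : 0 < s by rewrite /s; nra.
pose c' := p * B ^+ n + (1 - p) * c.
have c'c : 3 * c' < 1 by rewrite /c'; nra.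
have hs M : word_sum (letters M) n s <= c'.
  apply: (@le_trans _ _ (p * word_sum (letters M) n (1/4) + (1 - p) * word_sum (letters M) n t)).
    rewrite /word_sum !mulr_sumr -big_split /=; apply: ler_sum => w _.
    by apply: convex_powR_exp; rewrite ?(rho_gt0 S) ?p1 ?ltW.
  by apply: lerD; apply: ler_wpM2l => //; lra.
have c'0 : 0 <= c' := le_trans (word_sum_ge0 _ _ _ _ _) (hs 0%N).
have s3 : 3 `^ s <= 3 :> R by apply: powR3_le; rewrite ltW //=; lra.
have n0 : (0 < n)%N.
  by case: n hc {B1 Bn p p0 p1 pB s st s0 c' c'c hs c'0 s3} => // /(_ 0%N); rewrite word_sum0; lra.
apply: le_lt_trans st; apply: hdim_le; first exact: ltW.
apply: (hausdorff_measure_eq0 S) => // e e0 n1.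
have [|||k hk] := @geom_small R 1 (3 * c') e => //; first by apply/andP; split => //; lra.
exists ((maxn n1 k) * n)%N.
  by rewrite (leq_trans (leq_maxl n1 k)) // leq_pmulr.
move=> M; apply: ltW; apply: le_lt_trans (hk (maxn n1 k) (leq_maxr _ _)); rewrite [leRHS]mul1r.
apply: (word_sum_mul_le S); first exact: ltW.
by apply: ler_pM; rewrite ?powR_ge0 ?word_sum_ge0.
Qed.

Lemma hdim_lt_sum t (q : R) : 1/4 < t <= 1 -> q < 1 ->
  (forall L z, uniq L -> nm z <= 1/16 -> \sum_(a <- L) der a z `^ t <= q) -> hdim < t.
Proof.
move=> t41 q1 hq.
have q0 : 0 <= q by have := hq [::] 0 isT (@nm0_small R); rewrite big_nil.
have [|| |m hm] := @geom_small R 3 q 1 => //; first by rewrite q0.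
apply: (@hdim_lt_word_sum m _ (q ^+ m)) => //; first exact: hm.
by move=> M; apply: (word_sum_le S) => x x1; apply: hq => //; exact: letters_uniq.
Qed.

(** Otherwise [hdim_lt_word_sum] would apply at the dimension itself, since [3 * (1/4) < 1]. *)
Lemma word_sum_hdim_ge n : exists M, 1/4 <= word_sum (letters M) n hdim.
Proof.
apply: contrapT => /forallNP h; suff : hdim < hdim by rewrite ltxx.
apply: (@hdim_lt_word_sum n _ (1/4)); [|lra|].
  by have := hdim_ge_third; have := hdim_le_half; lra.
by move=> M; rewrite leNgt; apply/negP => /ltW; exact: h.
Qed.

(** The surplus exponent gives a factor [rho w ^ (t - hdim)], and [rho w <= (1/4) ^ n]. *)
Lemma word_sum_decay L n t : uniq L -> hdim <= t -> word_sum L n t <= 9 * ((1/4) `^ (t - hdim)) ^+ n.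
Proof.
move=> uL ht; apply: le_trans (ler_wpM2r _ (word_sum_hdim_le n uL)); last first.
  by rewrite exprn_ge0 // powR_ge0.
rewrite /word_sum mulr_suml big_seq [leRHS]big_seq; apply: ler_sum => w wW.
have sw : size w = n by move: wW; rewrite mem_words => /andP[/eqP].
rewrite (_ : rho w `^ t = rho w `^ hdim * rho w `^ (t - hdim)); last first.
  by rewrite -powRD_gt0 ?(rho_gt0 S) // addrC subrK.
apply: ler_wpM2l; first exact: powR_ge0.
rewrite -powR_mulrn ?powR_ge0 // powRAC powR_mulrn; last lra.
apply: ge0_ler_powR; rewrite ?nnegrE ?subr_ge0 ?(rho_ge0 S) ?exprn_ge0 //.
by rewrite -sw (rho_le S).
Qed.

End Dimension.

(** * Packing measure *)

Section PackingMeasure.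
Context {R : realType}.
Implicit Types (A : set R[i]) (t d : R) (P : set (R[i] * R)).

Lemma delta_packing0 d A : delta_packing d A set0.
Proof. by split => [p []|p q []]. Qed.

Lemma packing_pre_ge0 t A : (0 <= packing_pre t A)%E.
Proof.
apply: le_ereal_inf_tmp => _ [d _ <-].
by apply: ereal_sup_ubound; exists set0; [exact: delta_packing0|rewrite esum_set0].
Qed.

Lemma packing_measure_ge0 t A : (0 <= packing_measure t A)%E.
Proof.
apply: le_ereal_inf_tmp => _ [B _ <-].
by apply: nneseries_ge0 => k _ _; apply: packing_pre_ge0.
Qed.

Lemma esum_le_finite (T : choiceType) (P : set T) (f : T -> R) (C : R) :
  (forall s : seq T, uniq s -> (forall p, p \in s -> P p) -> \sum_(p <- s) f p <= C) ->
  (\esum_(p in P) (f p)%:E <= C%:E)%E.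
Proof.
move=> h; apply: ge_ereal_sup => _ [F [finF FP] <-].
rewrite fsbig_finite //= sumEFin lee_fin; apply: h; first exact: finmap.fset_uniq.
by move=> p; rewrite in_fset_set // => /set_mem/FP.
Qed.

Lemma esum_ge_finite (T : choiceType) (P : set T) (f : T -> R) (s : seq T) :
  uniq s -> (forall p, p \in s -> P p) ->
  ((\sum_(p <- s) f p)%:E <= \esum_(p in P) (f p)%:E)%E.
Proof.
move=> us sP; apply: ereal_sup_ubound; exists [set` s].
  by split; [exact: finite_seq|move=> p /= /sP].
by rewrite -fsbig_seq // sumEFin.
Qed.

Lemma sum_geom_le (q : R) n : 0 <= q < 1 -> \sum_(k < n) q ^+ k <= (1 - q)^-1.
Proof.
move=> /andP[q0 q1]; have q1' : 0 < 1 - q by lra.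
rewrite -[leRHS]mul1r ler_pdivlMr //.
suff -> : (\sum_(k < n) q ^+ k) * (1 - q) = 1 - q ^+ n by rewrite gerBl exprn_ge0.
elim: n => [|n IH]; first by rewrite big_ord0 mul0r expr0 subrr.
rewrite big_ord_recr mulrDl IH exprS /=; ring.
Qed.

End PackingMeasure.

(** * Packing sums above the dimension *)

Section PackingUpper.
Context {R : realType}.
Variables (phi : letter -> R[i] -> R[i]) (der : letter -> R[i] -> R).
Hypothesis S : conformal_system phi der.
Implicit Types (a b : letter) (u v w : seq letter) (z x y : R[i]) (t : R).
Local Notation rho := (rho phi der).
Local Notation wmap := (wmap phi).
Local Notation word_sum := (word_sum phi der).
Local Notation J := (limit_set phi closed_disk).
Local Notation hdim := (hdim phi).

(** The label of a ball is a parent word with an optional letter: [None] when the ball contains the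
    image of 0 under the parent, [Some a] when it is only known to contain the image under the
    child. *)
Let opt_seq (o : option letter) : seq letter := if o is Some a then [:: a] else [::].
Let opt_weight (o : option letter) : R :=
  if o is Some a then (a.1.+1%:R ^+ 3)^-1 else 1.

Let opt_weight_ge0 o : 0 <= opt_weight o.
Proof. by case: o => //= a; rewrite invr_ge0 exprn_ge0. Qed.

(* Let [v ++ [:: a]] be the first coding cylinder contained in the ball. Either
   the ball contains [wmap v 0], or its radius is at most the distance from
   its centre to [wmap v 0], which is of order [rho v / (a.1 + 1) ^ 3]. *)
Lemma ball_label z (r : R) : J z -> 0 < r <= 1 ->
  exists vo : seq letter * option letter,
    cball z r (wmap (vo.1 ++ opt_seq vo.2) 0) /\ r <= 6 * (rho vo.1 * opt_weight vo.2).
Proof.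
rewrite (limit_setE S) => -[s _ <-] /andP[r0 r1].
have ex : exists k, 6 * rho (mkseq s k) <= r.
  have [|||k hk] := @geom_small R 6 (1/4) r => //; first lra.
  exists k; apply: ltW; apply: le_lt_trans (hk k (leqnn k)).
  by rewrite ler_pM2l // -{2}(size_mkseq s k) (rho_le S).
have [k hk kmin] := ex_minnP ex.
case: k hk kmin => [|k] hk kmin; first by move: hk; rewrite /rho /=; lra.
set v := mkseq s k; pose a := s k.
have rv : r < 6 * rho v by rewrite ltNge; apply/negP => /kmin; rewrite ltnn.
have ck : code S s = wmap v (phi a (code S (shift k.+1 s))).
  rewrite (code_shift S k.+1 s) mkseqS -cats1 wmap_cat //.
have c1 := code_le1 S (shift k.+1 s).
have pc1 : nm (phi a (code S (shift k.+1 s))) <= 1 by have := cs_small S a c1; lra.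
have [le|lt] := leP (nm (code S s - wmap v 0)) r.
  by exists (v, None); rewrite /cball /= cats0 cdistE mulr1; split => //; exact: ltW.
exists (v, Some a) => /=; split.
  rewrite /cball /= cdistE cats1 -mkseqS (code_shift S k.+1 s).
  by apply: le_trans hk; apply: (wmap_diam S) => //; exact: nm0_le1.
apply: le_trans (ltW lt) _; rewrite ck.
apply: le_trans (wmap_dist_le S v pc1 (@nm0_le1 R)) _; rewrite subr0.
have := cs_decay S a c1; have := rho_gt0 S v.
set N := _ ^+ 3; set m := nm _ => p0 hm.
rewrite (_ : 6 * (rho v * N^-1) = 3 * rho v * (2 / N)); last by ring.
by rewrite ler_wpM2l // mulr_ge0 // ltW.
Qed.

(** Equal labels would put a common point in two balls, so disjointness makes labels injective and
    the sum is bounded by a sum over labels. The sum over the optional letter converges because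
    [3 * t > 1], the sum over words by [word_sum_decay]. *)
Lemma packing_sum_bounded t : hdim < t -> exists2 C : R, 0 < C &
  forall P, delta_packing 1 J P -> forall F, uniq F -> (forall p, p \in F -> P p) ->
  \sum_(p <- F) (2 * p.2) `^ t <= C.
Proof.
move=> ht; have h3 := hdim_ge_third S; have t0 : 0 < t by lra.
have [|C1 C10 hC1] := @letter_psum_bounded R (3 * t); first lra.
pose q : R := (1/4) `^ (t - hdim).
have q01 : 0 <= q < 1.
  rewrite powR_ge0 /=; have <- : 1 `^ (t - hdim) = 1 :> R by rewrite powR1.
  by apply: gt0_ltr_powR; rewrite ?subr_gt0 ?nnegrE //; lra.
have q1 : 0 < 1 - q by lra.
exists (12 `^ t * (9 * (1 - q)^-1 * (1 + C1))).
  rewrite !mulr_gt0 ?powR_gt0 ?invr_gt0 //; lra.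
move=> P [hP tP] F uF FP.
have /choice[lab hlab] : forall p, exists vo : seq letter * option letter, P p ->
    cball p.1 p.2 (wmap (vo.1 ++ opt_seq vo.2) 0) /\
    p.2 <= 6 * (rho vo.1 * opt_weight vo.2).
  move=> p.
  have [Pp|nPp] := pselect (P p); last by exists ([::], None).
  by have [/ball_label h r01] := hP p Pp; have [vo hvo] := h _ r01; exists vo.
have ul : uniq (map lab F).
  rewrite map_inj_in_uniq // => p p' /FP Pp /FP Pp' e.
  apply: (tP p p' Pp Pp'); exists (wmap ((lab p).1 ++ opt_seq (lab p).2) 0).
  by split; [exact: (hlab p Pp).1|rewrite e; exact: (hlab p' Pp').1].
pose g (vo : seq letter * option letter) : R := rho vo.1 `^ t * opt_weight vo.2 `^ t.
apply: (@le_trans _ _ (12 `^ t * \sum_(vo <- map lab F) g vo)).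
  rewrite big_map mulr_sumr big_seq [leRHS]big_seq; apply: ler_sum => p /FP Pp.
  have [_ hr] := hlab p Pp; have [_ /andP[r0 _]] := hP p Pp.
  rewrite /g -!powRM ?mulr_ge0 ?(rho_ge0 S) ?opt_weight_ge0 //.
  apply: ge0_ler_powR; rewrite ?nnegrE ?mulr_ge0 ?(rho_ge0 S) ?opt_weight_ge0 ?(ltW r0) ?(ltW t0) //.
  lra.
rewrite ler_pM2l ?powR_gt0 //.
have [M hM] := subset_letters (flatten [seq vo.1 ++ opt_seq vo.2 | vo <- map lab F]).
pose N := (\max_(vo <- map lab F) size vo.1).+1.
pose V := flatten [seq words (letters M) k | k <- iota 0 N].
have sub : {subset map lab F <= [seq (v, o) | v <- V, o <- None :: map Some (letters M)]}.
  move=> [v o] voF; have hl b : b \in v ++ opt_seq o -> b \in letters M.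
    move=> bv; apply: hM; apply/flattenP; exists (v ++ opt_seq o) => //.
    by apply/mapP; exists (v, o).
  apply/allpairsP; exists (v, o); split => //=.
    apply/flattenP; exists (words (letters M) (size v)).
      apply: map_f; rewrite mem_iota ltnS (big_rem _ voF) /=.
      exact: leq_maxl.
    rewrite mem_words eqxx; apply/allP => b bv; apply: hl; by rewrite mem_cat bv.
  case: o hl {voF} => [a|] hl; last by rewrite mem_head.
  by rewrite inE /= map_f // hl // mem_cat mem_head orbT.
apply: le_trans (ler_sum_subset ul sub _) _.
  by move=> vo; rewrite mulr_ge0 ?powR_ge0.
rewrite big_allpairs /=.
have inner v : \sum_(o <- None :: map Some (letters M)) g (v, o) <= rho v `^ t * (1 + C1).
  rewrite big_cons big_map /g /= powR1 -mulr_sumr -mulrDr.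
  apply: ler_wpM2l; rewrite ?powR_ge0 // lerD2l.
  apply: le_trans (hC1 _ (letters_uniq M)); apply: ler_sum => b _.
  by rewrite -powR_invn // -powRrM mulNr.
apply: le_trans (ler_sum _ (fun v _ => inner v)) _; rewrite -mulr_suml.
apply: ler_wpM2r; first lra.
rewrite big_flatten big_map.
have -> : iota 0 N = index_iota 0 N by rewrite /index_iota subn0.
rewrite big_mkord; apply: le_trans (_ : \sum_(k < N) 9 * q ^+ k <= _).
  by apply: ler_sum => k _; apply: (word_sum_decay S); [exact: letters_uniq|exact: ltW].
by rewrite -mulr_sumr ler_pM2l // sum_geom_le.
Qed.

(** Packing sums are bounded at an intermediate exponent [s]; passing to [t] gains
    [(2 * d) ^ (t - s)], which tends to 0 with [d]. *)
Lemma packing_pre_eq0 t : hdim < t -> packing_pre t J = 0%E.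
Proof.
move=> ht; apply/eqP; rewrite eq_le packing_pre_ge0 andbT; apply: ereal_le_eps => e e0.
pose s := (hdim + t) / 2.
have hs : hdim < s by rewrite /s; lra.
have st : 0 < t - s by rewrite /s; lra.
have [C C0 hC] := packing_sum_bounded hs.
have eC : 0 < e / C by rewrite divr_gt0.
pose d := Num.min 1 ((e / C) `^ (t - s)^-1 / 2).
have d0 : 0 < d by rewrite lt_min ltr01 /= divr_gt0 // powR_gt0.
have d1 : d <= 1 by rewrite ge_min lexx.
have hd : (2 * d) `^ (t - s) <= e / C.
  have -> : e / C = ((e / C) `^ (t - s)^-1) `^ (t - s).
    by rewrite -powRrM mulVf ?gt_eqF // powRr1 // ltW.
  apply: ge0_ler_powR; rewrite ?nnegrE ?powR_ge0 ?mulr_ge0 ?(ltW st) ?(ltW d0) //.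
  have : d <= (e / C) `^ (t - s)^-1 / 2 by rewrite ge_min lexx orbT.
  by rewrite ler_pdivlMr // mulrC.
apply: ge_ereal_inf; eexists; first by exists d.
apply: ge_ereal_sup => _ [P [hP tP] <-]; apply: esum_le_finite => F uF FP.
have P1 : delta_packing 1 J P.
  split => // p /hP[Jp /andP[-> r]]; split => //; exact: le_trans r d1.
apply: (@le_trans _ _ ((e / C) * \sum_(p <- F) (2 * p.2) `^ s)); last first.
  by rewrite mulrAC ler_pdivrMr // ler_pM2l // (hC P).
rewrite mulr_sumr big_seq [leRHS]big_seq; apply: ler_sum => p /FP /hP[_ /andP[r0 r]].
have r2 : 0 < 2 * p.2 by lra.
rewrite -{1}(subrK s t) powRD_gt0 // ler_wpM2r ?powR_ge0 //.
apply: le_trans hd; apply: ge0_ler_powR; rewrite ?nnegrE ?(ltW st) //; lra.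
Qed.

Lemma packing_measure_eq0 t : hdim < t -> packing_measure t J = 0%E.
Proof.
move=> ht; apply/eqP; rewrite eq_le packing_measure_ge0 andbT.
apply: ereal_inf_lbound; exists (fun=> J); first by move=> z Jz; exists 0%N.
by apply: eseries0 => k _ _; exact: packing_pre_eq0.
Qed.

End PackingUpper.

(** * Infinite packing measure at the dimension *)

Lemma mkseq_cat_prefix (T : Type) (s : nat -> T) (u v : seq T) :
  mkseq s (size (u ++ v)) = u ++ v -> mkseq s (size u) = u.
Proof.
move=> /(congr1 (take (size u))); rewrite take_size_cat // => e; rewrite -[RHS]e.
by rewrite /mkseq -map_take take_iota size_cat (minn_idPl (leq_addr _ _)).
Qed.

(** Words stopped at their first big letter form an antichain for the prefix order. *)
Lemma prefix_rcons_notin (T : eqType) (u u' : seq T) a a' :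
  a \notin u' -> prefix (rcons u a) (rcons u' a') -> u = u' /\ a = a'.
Proof.
move=> au' /prefixP[q]; case/lastP: q => [|q b].
  by rewrite cats0 => /rcons_inj[-> ->].
rewrite -rcons_cat => /rcons_inj[eu' _]; move: au'.
by rewrite eu' mem_cat mem_rcons mem_head.
Qed.

Lemma flatten_words_uniq (T : eqType) (L : seq T) m n : uniq L ->
  uniq (flatten [seq words L k | k <- iota m n]).
Proof.
move=> uL; elim: n m => //= n IH m.
rewrite cat_uniq IH andbT words_uniq //=.
apply/hasPn => u /flattenP[W /mapP[j]]; rewrite mem_iota => /andP[mj _] -> uj.
move: uj; rewrite /= !mem_words => /andP[/eqP -> _].
by rewrite gtn_eqF.
Qed.

Lemma powR_archi (R : realType) (X s : R) n1 : 0 <= X -> 0 < s ->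
  exists2 n0 : nat, (n1 <= n0)%N & X <= n0.+1%:R `^ s.
Proof.
move=> X0 s0; have [n2 hn2] : exists n2 : nat, X `^ s^-1 <= n2%:R.
  by have /ltW := archi_boundP (powR_ge0 X s^-1); eexists; eauto.
exists (maxn n1 n2); first exact: leq_maxl.
have sn0 : s != 0 by rewrite gt_eqF.
have -> : X = (X `^ s^-1) `^ s by rewrite -powRrM mulVf // powRr1.
apply: ge0_ler_powR; rewrite ?nnegrE ?powR_ge0 ?ler0n //; first exact: ltW.
by apply: le_trans hn2 _; rewrite ler_nat leqW // leq_maxr.
Qed.

Section PackingLower.
Context {R : realType}.
Variables (phi : letter -> R[i] -> R[i]) (der : letter -> R[i] -> R).
Hypothesis S : conformal_system phi der.
Implicit Types (a b : letter) (u v w : seq letter) (z x y : R[i]) (t : R).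
Local Notation rho := (rho phi der).
Local Notation wmap := (wmap phi).
Local Notation word_sum := (word_sum phi der).
Local Notation J := (limit_set phi closed_disk).
Local Notation h := (hdim phi).

(* Baire category on the space of codes. *)
Lemma cover_somewhere_dense (B : nat -> set R[i]) : J `<=` \bigcup_k B k ->
  exists k w, forall v, exists s, mkseq s (size (w ++ v)) = w ++ v /\ B k (code S s).
Proof.
move=> JB; apply: contrapT => hno.
have hv k w : exists v, forall s, mkseq s (size (w ++ v)) = w ++ v -> ~ B k (code S s).
  apply: contrapT => /forallNP hv; apply: hno; exists k, w => v.
  by have := hv v => /existsNP[s /not_implyP[e /contrapT Bs]]; exists s.
pose Q (p q : nat * seq letter) := q.1 = p.1.+1 /\
  (exists2 v, v != [::] & q.2 = p.2 ++ v) /\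
  forall s, mkseq s (size q.2) = q.2 -> ~ B p.1 (code S s).
have [//||f [f0 hf]] := @invariant_path _ (fun=> True) Q (0%N, [::]).
  move=> [k w] _; have [v hv'] := hv k w.
  (* The extension [v] may be empty; one more letter makes it strict, as [chain_limit] requires. *)
  exists (k.+1, (w ++ v) ++ [:: (0%N, ord0)]); split => //; split => //; split => /=.
    by exists (v ++ [:: (0%N, ord0)]); [case: (v)|rewrite catA].
  by move=> s /mkseq_cat_prefix; exact: hv'.
have fk k : (f k).1 = k.
  by elim: k => [|k IH]; [rewrite f0|have [_ [-> _]] := hf k; rewrite IH].
have [s hs] : exists s, forall k, (f k).2 = mkseq s (size (f k).2) /\ (k <= size (f k).2)%N.
  by apply: chain_limit => k; have [_ [_ [? _]]] := hf k.
have : J (code S s) by rewrite (limit_setE S); exists s.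
move=> /JB[k _]; have [_ [_ [_ hk]]] := hf k; rewrite -{1}(fk k); apply: hk.
by have [e _] := hs k.+1; rewrite -e.
Qed.

Lemma hdim01 : 0 <= h <= 1.
Proof. by have := hdim_gt0 S; have := hdim_le_half S; lra. Qed.

Lemma hdim_ge0 : 0 <= h. Proof. by have /andP[] := hdim01. Qed.

Definition big_letters n0 M : seq letter := [seq a <- letters M | (n0 <= a.1)%N].

Section FirstBigLetter.
Variables n0 M : nat.
Let L := letters M.
Let Ls := letters n0.
Let Lb := big_letters n0 M.
Let p : R := \sum_(a <- Lb) rho [:: a] `^ h.

(** The first [k] letters are small, the other [m] range over all of [letters M]. *)
Let mixed k m : R :=
  \sum_(u <- words Ls k) \sum_(v <- words L m) rho (u ++ v) `^ h.

(** The letter after the small block is either small or big. A big one splits the word in three at a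
    cost of [3 ^ h] twice, hence at most 9, and the free tail contributes at most 9 by
    [word_sum_hdim_le]; so 81. *)
Let mixed_step k m : mixed k m.+1 <= mixed k.+1 m + 81 * p * word_sum Ls k h.
Proof.
have e : mixed k.+1 m = \sum_(u <- words Ls k) \sum_(a <- Ls) \sum_(v <- words L m)
    rho (u ++ a :: v) `^ h.
  rewrite /mixed -(addn1 k) sum_words_cat; apply: eq_bigr => u _.
  rewrite sum_wordsS; apply: eq_bigr => a _; rewrite big_seq1.
  by apply: eq_bigr => v _; rewrite -catA.
rewrite e /word_sum mulr_sumr -big_split /=; apply: ler_sum => u _.
rewrite sum_wordsS.
pose F a := \sum_(v <- words L m) rho (u ++ a :: v) `^ h.
apply: (@le_trans _ _ (\sum_(a <- Ls ++ Lb) F a)).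
  apply: ler_sum_subset; first exact: letters_uniq.
    move=> a aL; rewrite mem_cat mem_filter aL mem_letters andbT.
    by have [|] := ltnP a.1 n0.
  by move=> a; apply: sumr_ge0 => v _; apply: powR_ge0.
rewrite big_cat /= lerD2l mulrAC /p mulr_sumr.
have -> : \sum_(i <- Lb) 81 * rho u `^ h * rho [:: i] `^ h =
          \sum_(i <- Lb) 9 * rho u `^ h * rho [:: i] `^ h * 9.
  by apply: eq_bigr => a _; ring.
apply: ler_sum => a _.
apply: (@le_trans _ _ (9 * rho u `^ h * rho [:: a] `^ h * word_sum L m h)); last first.
  apply: ler_wpM2l; first by rewrite !mulr_ge0 ?powR_ge0.
  by apply: (word_sum_hdim_le S); exact: letters_uniq.
rewrite /F /word_sum mulr_sumr; apply: ler_sum => v _.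
have h3 := powR3_le hdim01.
rewrite -cat1s; apply: le_trans (rho_powR_cat_le S u _ hdim_ge0) _.
apply: le_trans (ler_wpM2l _ (rho_powR_cat_le S [:: a] v hdim_ge0)) _.
  by rewrite mulr_ge0 ?powR_ge0.
rewrite -!mulrA.
set A := rho u `^ h; set B := rho [:: a] `^ h; set C := rho v `^ h.
have ABC : 0 <= A * (B * C) by rewrite !mulr_ge0 ?powR_ge0.
have -> : 3 `^ h * (A * (3 `^ h * (B * C))) = (3 `^ h * 3 `^ h) * (A * (B * C)).
  by ring.
apply: ler_wpM2r => //; have -> : 9 = 3 * 3 :> R by ring.
by apply: ler_pM; rewrite ?powR_ge0.
Qed.

(** Words are sorted by the position of their first big letter, by iterating [mixed_step]. *)
Lemma word_sum_first_big_letter N :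
  word_sum L N h <= word_sum Ls N h + 81 * p * \sum_(k < N) word_sum Ls k h.
Proof.
suff H m k : mixed k m <= word_sum Ls (k + m) h + 81 * p * \sum_(k <= i < k + m) word_sum Ls i h.
  have := H N 0%N; rewrite add0n big_mkord; apply: le_trans.
  by rewrite /mixed big_seq1.
elim: m k => [|m IH] k.
  rewrite addn0 big_geq // mulr0 addr0 /mixed.
  by under eq_bigr do rewrite big_seq1 cats0.
apply: le_trans (mixed_step k m) _; rewrite addnS -addSn.
rewrite [X in _ <= _ + _ * X]big_ltn ?leq_addr // mulrDr.
by rewrite [in leRHS](addrC (_ * word_sum _ _ _)) addrA lerD2r IH.
Qed.

(** The decay [n ^ (-6h)] of cylinders is compared with the weight [n ^ (-4h)] of the balls; the
    quotient is at most [(n0 + 1) ^ (-2h)]. *)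
Lemma sum_big_letters_le :
  p <= 2 * n0.+1%:R `^ (- (2 * h)) * \sum_(a <- Lb) a.1.+1%:R `^ (- (4 * h)).
Proof.
rewrite /p mulr_sumr big_seq [leRHS]big_seq; apply: ler_sum => a.
rewrite mem_filter => /andP[na _]; rewrite /rho /= mulr1.
apply: le_trans (der_powR_decay S a hdim01 (@nm0_le1 R)) _.
have a0 : 0 < a.1.+1%:R :> R by rewrite ltr0n.
have -> : - (6 * h) = - (2 * h) + - (4 * h) by ring.
rewrite powRD_gt0 // mulrA ler_wpM2r ?powR_ge0 // ler_wpM2l //.
rewrite !powRN lef_pV2 ?posrE ?powR_gt0 ?ltr0n //.
apply: ge0_ler_powR; rewrite ?nnegrE ?ler0n ?ler_nat //.
by rewrite mulr_ge0 ?hdim_ge0.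
Qed.

End FirstBigLetter.

Lemma packing_weight_unbounded (A : R) n1 : exists n0 N M, (n1 <= n0)%N /\
  A <= (\sum_(k < N) word_sum (letters n0) k h) *
       (\sum_(a <- big_letters n0 M) a.1.+1%:R `^ (- (4 * h))).
Proof.
have h0 := hdim_gt0 S.
pose A' := Num.max A 1; have A1 : 1 <= A' by rewrite le_max lexx orbT.
have AA : A <= A' by rewrite le_max lexx.
(* This is [8 * 162], the constant in [h5] below. *)
pose K : R := 36 * 36; have [||n0 n10 hn0] := @powR_archi R (K * A') (2 * h) n1.
- by rewrite /K !mulr_ge0 //; lra.
- lra.
exists n0.
pose G M : R := \sum_(a <- big_letters n0 M) a.1.+1%:R `^ (- (4 * h)).
pose T N := \sum_(k < N) word_sum (letters n0) k h.
have T0 N : 0 <= T N by apply: sumr_ge0 => k _; exact: word_sum_ge0.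
(* If the sums over small letters stay above 1/8, their total diverges with [N] and one big letter
   suffices. Otherwise, at some length they drop below 1/8 while the full sum is at least 1/4, so
   words with a big letter carry at least 1/8. *)
have [hS|/existsNP[N /negP]] := pselect (forall N, 1/8 <= word_sum (letters n0) N h).
  have G0 : 0 < G n0.+1.
    rewrite /G (big_rem (n0, ord0)) /=; last by rewrite mem_filter mem_letters leqnn ltnS leqnn.
    by rewrite ltr_pwDl ?powR_gt0 ?ltr0n // sumr_ge0 // => a _; exact: powR_ge0.
  have TN N : N%:R / 8 <= T N.
    apply: (@le_trans _ _ (\sum_(k < N) 1/8)); last by apply: ler_sum => k _.
    by rewrite sumr_const card_ord -[leRHS]mulr_natl mulrA mulr1.
  have [N hN] : exists N : nat, 8 * A' / G n0.+1 <= N%:R.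
    have := archi_boundP (_ : 0 <= 8 * A' / G n0.+1) => /(_ _)/ltW e.
    eexists; apply: e; rewrite divr_ge0 ?(ltW G0) //; lra.
  exists N, n0.+1; split => //.
  apply: le_trans AA _; rewrite -/(T N) -/(G n0.+1) -ler_pdivrMr //.
  apply: le_trans (TN N); move: hN.
  rewrite (_ : 8 * A' / G n0.+1 = 8 * (A' / G n0.+1)); last by ring.
  lra.
rewrite -ltNge => hN; have [M hM] := word_sum_hdim_ge S N.
exists N, M; split => //.
apply: le_trans AA _; rewrite -/(T N) -/(G M).
have h1 := word_sum_first_big_letter n0 M N; rewrite -/(T N) in h1.
have h2 := sum_big_letters_le n0 M; rewrite -/(G M) in h2.
set p := \sum_(a <- _) _ in h1 h2.
have q0 : 0 < n0.+1%:R `^ (2 * h) :> R by rewrite powR_gt0 ?ltr0n.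
have h3 : p * T N <= 2 * (n0.+1%:R `^ (2 * h))^-1 * (G M * T N).
  by rewrite mulrA -powRN ler_wpM2r.
have h4 : 1/8 <= 162 * (n0.+1%:R `^ (2 * h))^-1 * (G M * T N).
  have : 1/8 <= 81 * (p * T N) by rewrite mulrA; lra.
  lra.
have h5 : n0.+1%:R `^ (2 * h) <= 8 * 162 * (G M * T N).
  move: h4; rewrite mulrAC ler_pdivlMr //; lra.
by move: hn0; rewrite /K mulrC; lra.
Qed.

(** Radii are compared with the gap at any branching point [p], [b] of the stopped word. If [b] is
    not the last letter, the derivative decay [b ^ -6] already beats the gap [b ^ -4]. *)
Lemma stop_radius_le w u q p a b : rcons u a = p ++ b :: q ->
  rho (w ++ u) / a.1.+1%:R ^+ 4 <= 6 * (rho (w ++ p) / b.1.+1%:R ^+ 4).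
Proof.
have a0 : 1 <= a.1.+1%:R ^+ 4 :> R by rewrite exprn_ege1 // ler1n.
have b0 : 0 < b.1.+1%:R :> R by rewrite ltr0n.
have b4 : 0 < b.1.+1%:R ^+ 4 :> R by rewrite exprn_gt0.
case/lastP: q => [|q c].
  rewrite cats1 => /rcons_inj[-> ->].
  rewrite ler_peMl ?divr_ge0 ?(rho_ge0 S) ?(ltW b4) //; lra.
rewrite -rcons_cons -rcons_cat => /rcons_inj[-> _].
apply: (@le_trans _ _ (rho (w ++ p ++ b :: q))).
  by rewrite ler_pdivrMr ?(lt_le_trans ltr01) // ler_peMr ?(rho_ge0 S).
rewrite catA; apply: le_trans (rho_cat_le S _ _) _.
rewrite (_ : 6 * _ = 3 * rho (w ++ p) * (2 / b.1.+1%:R ^+ 4)); last by ring.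
apply: ler_wpM2l; first by rewrite mulr_ge0 ?(rho_ge0 S).
have m1 := wmap_le1 S q (@nm0_le1 R).
rewrite /rho /=; apply: (@le_trans _ _ (2 / b.1.+1%:R ^+ 6 * 1)).
  apply: ler_pM; [exact/ltW/(cs_der_gt0 S)| |exact: (cs_der_decay S)|exact: (rho_le1 S)].
  exact: (rho_ge0 S).
rewrite mulr1 ler_pM2l // lef_pV2 ?posrE ?exprn_gt0 //.
by apply: ler_weXn2l => //; rewrite ler1n.
Qed.

(** The centres are points of [B] in the cylinders of the words stopped at their first big letter,
    with radii proportional to the gap at that letter. *)
Lemma packing_pre_dense (B : set R[i]) w :
  (forall v, exists s, mkseq s (size (w ++ v)) = w ++ v /\ B (code S s)) ->
  packing_pre h B = +oo%E.
Proof.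
move=> hB; have h0 := hdim_gt0 S; have [c c0 gap] := cs_gap S.
apply/eqP; rewrite -leye_eq; apply: le_ereal_inf_tmp => _ [d /= d0 <-].
rewrite leye_eq; apply/eqP/eqyP => A A0.
(* With the factor 6 of [stop_radius_le], each radius is at most a twelfth of [rho (w ++ p)] times
   the gap; two of them stay below the third guaranteed by [wmap_dist_ge]. *)
pose eta := c / 72; have eta0 : 0 < eta by rewrite divr_gt0.
have rw := rho_gt0 S w.
pose kap := (2 * eta) `^ h * (rho w `^ h / 3 `^ h).
have kap0 : 0 < kap by rewrite !mulr_gt0 ?invr_gt0 ?powR_gt0 ?mulr_gt0.
(* Big letters have index at least [n1], which makes all radii at most [d]. *)
have [n1 hn1] : exists n1 : nat, eta / d <= n1%:R.
  have := archi_boundP (_ : 0 <= eta / d) => /(_ _)/ltW e.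
  by eexists; apply: e; rewrite divr_ge0 ?ltW.
have [n0 [N [M [n10 hA]]]] := packing_weight_unbounded (A / kap) n1.
pose Us := flatten [seq words (letters n0) k | k <- iota 0 N].
have UsP u : u \in Us -> forall a, a \in u -> (a.1 < n0)%N.
  move=> /flattenP[W /mapP[k _ ->]]; rewrite mem_words => /andP[_ /allP al] a /al.
  by rewrite /= mem_letters.
have uUs : uniq Us by apply: flatten_words_uniq; exact: letters_uniq.
pose V := [seq (u, a) | u <- Us, a <- big_letters n0 M].
have uV : uniq V.
  by apply: allpairs_uniq => //; [exact/filter_uniq/letters_uniq|move=> [? ?] [? ?]].
have VP ua : ua \in V -> ua.1 \in Us /\ (n0 <= ua.2.1)%N.
  by move=> /allpairsP[[u a] /= [uU + ->]]; rewrite mem_filter => /andP[na _].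
have /choice[co hco] : forall ua : seq letter * letter, exists s,
    mkseq s (size (w ++ rcons ua.1 ua.2)) = w ++ rcons ua.1 ua.2 /\ B (code S s).
  by move=> ua; exact: hB.
pose rad (ua : seq letter * letter) := eta * (rho (w ++ ua.1) / ua.2.1.+1%:R ^+ 4).
have rad0 ua : 0 < rad ua.
  by rewrite mulr_gt0 // divr_gt0 ?(rho_gt0 S) // exprn_gt0 // ltr0n.
pose ball ua := (code S (co ua), rad ua).
have sep ua ub : ua \in V -> ub \in V -> ua != ub ->
    rad ua + rad ub < nm (code S (co ua) - code S (co ub)).
  move=> /VP[uaU na] /VP[ubU nb] ne.
  have nua : ua.2 \notin ub.1 by apply/negP => /(UsP _ ubU); rewrite ltnNge na.
  have nub : ub.2 \notin ua.1 by apply/negP => /(UsP _ uaU); rewrite ltnNge nb.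
  have [|| p [a [b [u [v [ab eu ev]]]]]] :=
    @prefix_split _ (rcons ua.1 ua.2) (rcons ub.1 ub.2).
  - apply: contra ne => /(prefix_rcons_notin nua)[e1 e2].
    by rewrite (surjective_pairing ua) (surjective_pairing ub) e1 e2.
  - apply: contra ne => /(prefix_rcons_notin nub)[e1 e2].
    by rewrite (surjective_pairing ua) (surjective_pairing ub) e1 e2.
  have ra := stop_radius_le w eu; have rb := stop_radius_le w ev.
  have cc uc q e : mkseq (co uc) (size (w ++ rcons uc.1 uc.2)) = w ++ rcons uc.1 uc.2 ->
      rcons uc.1 uc.2 = p ++ e :: q ->
      exists2 z, nm z <= 1/16 & code S (co uc) = wmap (w ++ p) (phi e z).
    move=> em er; rewrite (code_shift S (size (w ++ rcons uc.1 uc.2))) em er catA wmap_cat /=.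
    by eexists; last reflexivity; apply: (wmap_small S); exact: code_small.
  have [z z1 ->] := cc _ _ _ (hco ua).1 eu.
  have [x x1 ->] := cc _ _ _ (hco ub).1 ev.
  have pz := small_le1 (wmap_small S [:: a] z1).
  have px := small_le1 (wmap_small S [:: b] x1).
  have dd := wmap_dist_ge S (w ++ p) pz px; rewrite /= in dd.
  have ga := gap a b z x ab z1 x1.
  have gb : c / b.1.+1%:R ^+ 4 <= nm (phi a z - phi b x).
    by rewrite nmB; apply: gap => //; rewrite eq_sym.
  have r0 := rho_gt0 S (w ++ p).
  have Na : 0 < c / a.1.+1%:R ^+ 4 by rewrite divr_gt0 // exprn_gt0 // ltr0n.
  move: dd ga gb ra rb; rewrite /rad /eta; set X := nm _; set Y := nm _.
  set r := rho _; set ra := rho _ / _; set rb := rho _ / _ => dd ga gb hra hrb.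
  have X0 : 0 < X by apply: lt_le_trans ga.
  have Ha : c / 72 * ra <= r * X / 12.
    apply: (@le_trans _ _ (c / 72 * (6 * (r / a.1.+1%:R ^+ 4)))).
      by rewrite ler_pM2l // divr_gt0.
    rewrite (_ : c / 72 * _ = r * (c / a.1.+1%:R ^+ 4) / 12); last by field.
    by rewrite ler_pM2r // ler_pM2l.
  have Hb : c / 72 * rb <= r * X / 12.
    apply: (@le_trans _ _ (c / 72 * (6 * (r / b.1.+1%:R ^+ 4)))).
      by rewrite ler_pM2l // divr_gt0.
    rewrite (_ : c / 72 * _ = r * (c / b.1.+1%:R ^+ 4) / 12); last by field.
    by rewrite ler_pM2r // ler_pM2l.
  have rX : 0 < r * X by apply: mulr_gt0.
  lra.
have ballI : {in V &, injective ball}.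
  move=> ua ub uaV ubV [ec er]; apply/eqP; apply: contrapT => /negP ne.
  have := sep _ _ uaV ubV ne; rewrite ec subrr nm0.
  by have := rad0 ua; have := rad0 ub; lra.
have pack : delta_packing d B [set` map ball V].
  split => [p /mapP[ua uaV ->]|p q /mapP[ua uaV ->] /mapP[ub ubV ->]] /=.
    split; first exact: (hco ua).2.
    rewrite rad0 /=; have [_ na] := VP _ uaV.
    have N0 : 1 <= ua.2.1.+1%:R :> R by rewrite ler1n.
    have Nn : n1%:R <= ua.2.1.+1%:R :> R by rewrite ler_nat leqW // (leq_trans n10).
    have N4 : ua.2.1.+1%:R <= ua.2.1.+1%:R ^+ 4 :> R by apply: ler_eXnr.
    have e1 : eta <= d * ua.2.1.+1%:R.
      by rewrite mulrC -ler_pdivrMr //; apply: le_trans Nn.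
    have r1 := rho_le1 S (w ++ ua.1); have r0 := rho_gt0 S (w ++ ua.1).
    rewrite /rad mulrA ler_pdivrMr ?(lt_le_trans ltr01) ?(le_trans N0) //.
    nra.
  move=> [y []]; rewrite /cball /= !cdistE => hy hy'.
  apply/eqP; apply: contrapT => /negP ne.
  have neab : ua != ub by apply: contra ne => /eqP ->.
  have := sep _ _ uaV ubV neab; rewrite ltNge => /negP; apply.
  apply: le_trans (ler_nm_triangle y _ _) _; apply: lerD => //.
  by rewrite nmB.
apply: (@le_trans _ _ (\esum_(p in [set` map ball V]) ((2 * p.2) `^ h)%:E)%E); last first.
  by apply: ereal_sup_ubound; exists [set` map ball V].
have uB : uniq (map ball V) by rewrite map_inj_in_uniq.
apply: le_trans (esum_ge_finite (fun p => (2 * p.2) `^ h) uB (fun p pB => pB)).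
rewrite lee_fin big_map /V big_allpairs /=.
have -> : A = kap * (A / kap) by rewrite mulrCA mulfV ?mulr1 // gt_eqF.
apply: le_trans (ler_wpM2l (ltW kap0) hA) _.
rewrite mulr_suml mulr_sumr (_ : \sum_(i <- Us) _ = \sum_(k < N) \sum_(u <- words (letters n0) k)
  \sum_(a <- big_letters n0 M) (2 * rad (u, a)) `^ h); last first.
  rewrite /Us big_flatten big_map.
  have -> : iota 0 N = index_iota 0 N by rewrite /index_iota subn0.
  by rewrite big_mkord.
apply: ler_sum => k _; rewrite /word_sum mulr_suml mulr_sumr; apply: ler_sum => u _.
rewrite mulrA mulr_sumr; apply: ler_sum => a _; rewrite /rad /=.
have N0 : 0 < a.1.+1%:R :> R by rewrite ltr0n.
have eta20 : 0 <= 2 * eta by rewrite mulr_ge0 ?ltW.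
have q0 : 0 <= rho (w ++ u) / a.1.+1%:R ^+ 4.
  by rewrite divr_ge0 ?(rho_ge0 S) ?exprn_ge0.
rewrite mulrA (powRM _ eta20 q0).
rewrite [(rho _ / _) `^ _]powRM ?invr_ge0 ?(rho_ge0 S) ?exprn_ge0 //.
rewrite (_ : ((a.1.+1%:R ^+ 4)^-1 : R) `^ h = a.1.+1%:R `^ (- (4 * h))); last first.
  by rewrite -powR_invn ?(ltW N0) // -powRrM mulNr.
rewrite mulrA ler_wpM2r ?powR_ge0 // /kap -!mulrA ler_wpM2l ?powR_ge0 //.
have h3 : 0 < 3 `^ h :> R by rewrite powR_gt0.
rewrite mulrCA -ler_pdivlMl ?invr_gt0 // invrK.
exact: (rho_powR_cat_ge S _ _ (hdim_ge0)).
Qed.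

(** By the Baire argument some member of any cover is dense in a cylinder and already has infinite
    premeasure. *)
Lemma packing_measure_hdim : packing_measure h J = +oo%E.
Proof.
apply/eqP; rewrite -leye_eq; apply: le_ereal_inf_tmp => _ [B JB <-].
have [k [w /packing_pre_dense hk]] := cover_somewhere_dense JB.
rewrite -hk; apply: (@le_trans _ _ (\sum_(0 <= i < k.+1) packing_pre h (B i))%E).
  by rewrite big_nat_recr //= leeDr // sume_ge0 // => i _; exact: packing_pre_ge0.
by apply: nneseries_lim_ge => i _ _; exact: packing_pre_ge0.
Qed.

Lemma packing_pre_mono t A : t <= h -> (packing_pre h A <= packing_pre t A)%E.
Proof.
move=> th; apply: le_ereal_inf_tmp => _ [d /= d0 <-].
(* Radii at most 1/2 give [2 * p.2 <= 1], where powers decrease in the exponent. *)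
pose d' := Num.min d (1/2).
have d'0 : 0 < d' by rewrite lt_min d0; lra.
apply: ge_ereal_inf; eexists; first by exists d'.
apply: ge_ereal_sup => _ [P [hP tP] <-].
apply: (@le_trans _ _ (\esum_(p in P) ((2 * p.2) `^ t)%:E)%E).
  apply: le_esum => p /hP[_ /andP[p0 pd]]; rewrite lee_fin ger_powR //.
  have hd' : d' <= 1/2 by rewrite ge_min lexx orbT.
  by apply/andP; split; lra.
apply: ereal_sup_ubound; exists P => //; split => // p /hP[Ap /andP[p0 pd]].
by split => //; rewrite p0 (le_trans pd) // ge_min lexx.
Qed.

Theorem packing_dim_eq : packing_dim J = hausdorff_dim J.
Proof.
rewrite (hdimE S); apply/eqP; rewrite eq_le; apply/andP; split.
  apply/lee_addgt0Pr => e e0; rewrite -EFinD; apply: ereal_inf_lbound.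
  exists (h + e) => //; split; first by have := hdim_ge0; lra.
  by apply: (packing_measure_eq0 S); lra.
apply: le_ereal_inf_tmp => _ [t [t0 Pt] <-]; rewrite lee_fin leNgt; apply/negP => th.
have : (packing_measure h J <= packing_measure t J)%E; last first.
  by rewrite Pt packing_measure_hdim leye_eq.
apply: le_ereal_inf_tmp => _ [B JB <-].
apply: ge_ereal_inf; eexists; first by exists B.
apply: lee_nneseries => k *; first exact: packing_pre_ge0.
exact/packing_pre_mono/ltW.
Qed.

End PackingLower.

(** * The two systems *)

Section Rotations.
Context {R : realType}.

Lemma nm_complex (a b : R) : nm (Complex a b) ^+ 2 = a ^+ 2 + b ^+ 2.
Proof. by rewrite nm_sqr. Qed.

Definition rot (j : 'I_4) : R[i] := e2pi (j%:R / 4%:R).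

Lemma rotE j : rot j = nth 0 [:: Complex 1 0; Complex 0 1; Complex (-1) 0; Complex 0 (-1)] j.
Proof.
case: j => -[|[|[|[|//]]]] j4; rewrite /rot /e2pi /=.
- by rewrite mul0r mulr0 cos0 sin0.
- have -> : 2 * pi * (1 / 4) = pi / 2 :> R by field.
  by rewrite cos_pihalf sin_pihalf.
- have -> : 2 * pi * (2 / 4) = pi :> R by field.
  by rewrite cospi sinpi.
- have -> : 2 * pi * (3 / 4) = pi / 2 + pi :> R by field.
  by rewrite cosDpi sinDpi cos_pihalf sin_pihalf oppr0.
Qed.

Lemma nm_rot j : nm (rot j) = 1.
Proof.
apply/eqP; rewrite -(@eqrXn2 _ 2) ?nm_ge0 // expr1n rotE.
by case: j => -[|[|[|[|//]]]] j4; rewrite /= nm_complex; apply/eqP; ring.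
Qed.

Lemma nm_rotB j k : j != k -> 1 <= nm (rot j - rot k).
Proof.
move=> jk; rewrite -(@ler_pXn2r _ 2) ?nnegrE ?nm_ge0 // expr1n !rotE nm_sqr !raddfB /=.
by case: j jk => -[|[|[|[|//]]]] j4; case: k => -[|[|[|[|//]]]] k4 //= _; lra.
Qed.

End Rotations.

(** * Arithmetic of the sequence *)

Section Sequence.
Context {R : realType}.
Variable d : nat -> R.
Hypotheses (hd1 : d 1%N = 17) (hd2 : d 2%N = 19)
  (hd : forall n : nat, (3 <= n)%N -> d n = n%:R ^+ 3).

Lemma d_bounds n : n.+1%:R ^+ 3 <= d n.+1 <= 17 * n.+1%:R ^+ 3.
Proof.
case: n => [|[|n]]; first by rewrite hd1; lra.
  by rewrite hd2; lra.
rewrite hd // lexx /=; have : 0 <= n.+3%:R ^+ 3 :> R by rewrite exprn_ge0.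
lra.
Qed.

(** Equality holds for the first two steps, from 17 to 19 and from 19 to 27. *)
Lemma d_step n : d n.+1 + 2 * n.+1%:R ^+ 2 <= d n.+2.
Proof.
case: n => [|[|n]]; first by rewrite hd1 hd2; lra.
  by rewrite hd2 hd //; lra.
rewrite !hd // -(natr1 n.+3); have : 3 <= n.+3%:R :> R by rewrite ler_nat.
set x := n.+3%:R => x3; nra.
Qed.

Lemma d_incr n m : (n < m)%N -> d n.+2 <= d m.+1.
Proof.
elim: m => // m IH; rewrite ltnS leq_eqVlt => /orP[/eqP -> //|/IH h].
by apply: le_trans h _; apply: le_trans (d_step m); rewrite lerDl mulr_ge0 ?sqr_ge0.
Qed.

Lemma d_ge17 n : 17 <= d n.+1.
Proof.
case: n => [|n]; first by rewrite hd1.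
apply: le_trans (d_incr (ltn0Sn n)); rewrite hd2; lra.
Qed.

Lemma d_gap n m : (n < m)%N -> d n.+1 + 2 <= d m.+1.
Proof.
move=> nm_; apply: le_trans (d_incr nm_); apply: le_trans (d_step n).
by rewrite lerD2l ler_peMr // exprn_ege1 // ler1n.
Qed.

(** The step is at least [2 n^2] and the product of the two terms at most [17 n^3 * 136 n^3], with
    [136 = 17 * 8]; the constant is [2 / (17 * 136) = 1 / 34^2]. *)
Lemma d_inv_step n : (1/34 * (1/34)) / n.+1%:R ^+ 4 <= (d n.+1)^-1 - (d n.+2)^-1 /\
  (1/34 * (1/34)) / n.+2%:R ^+ 4 <= (d n.+1)^-1 - (d n.+2)^-1.
Proof.
have /andP[l1 u1] := d_bounds n; have /andP[l2 u2] := d_bounds n.+1.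
have st := d_step n; have D1 := d_ge17 n; have D2 := d_ge17 n.+1.
have x1 : 1 <= n.+1%:R :> R by rewrite ler1n.
have e2 : n.+2%:R = n.+1%:R + 1 :> R by rewrite natr1.
have H : (1/34 * (1/34)) / n.+1%:R ^+ 4 <= (d n.+1)^-1 - (d n.+2)^-1.
  have -> : (d n.+1)^-1 - (d n.+2)^-1 = (d n.+2 - d n.+1) / (d n.+1 * d n.+2).
    by field; rewrite !gt_eqF //; lra.
  rewrite ler_pdivlMr ?mulr_gt0 //; try lra.
  apply: (@le_trans _ _ (2 * n.+1%:R ^+ 2)); last lra.
  rewrite mulrAC ler_pdivrMr ?exprn_gt0 ?ltr0n //.
  have u2' : d n.+2 <= 136 * n.+1%:R ^+ 3.
    apply: le_trans u2 _; rewrite e2; set x := n.+1%:R in x1 *.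
    have : (x + 1) ^+ 3 <= (2 * x) ^+ 3 by rewrite ler_pXn2r ?nnegrE //; lra.
    by rewrite exprMn; lra.
  have : d n.+1 * d n.+2 <= 17 * n.+1%:R ^+ 3 * (136 * n.+1%:R ^+ 3).
    by apply: ler_pM => //; lra.
  have -> : 2 * n.+1%:R ^+ 2 * n.+1%:R ^+ 4 = 2 * (n.+1%:R ^+ 3 * n.+1%:R ^+ 3) :> R.
    by ring.
  lra.
split => //; apply: le_trans H.
rewrite ler_pM2l // lef_pV2 ?posrE ?exprn_gt0 ?ltr0n // ler_pXn2r ?nnegrE ?ler0n //.
by rewrite ler_nat.
Qed.

Lemma d_inv_gap n m : n != m -> (1/34 * (1/34)) / n.+1%:R ^+ 4 <= `|(d n.+1)^-1 - (d m.+1)^-1|.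
Proof.
have pos k : 0 < d k.+1 by have := d_ge17 k; lra.
rewrite neq_ltn => /orP[lt|lt].
  apply: le_trans (d_inv_step n).1 _; apply: le_trans (ler_norm _).
  by rewrite lerD2l lerN2 lef_pV2 ?posrE // d_incr.
case: n lt => // n; rewrite ltnS => lt.
apply: le_trans (d_inv_step n).2 _; rewrite distrC; apply: le_trans (ler_norm _).
rewrite lerD2r lef_pV2 ?posrE //; move: lt; rewrite leq_eqVlt => /orP[/eqP -> //|lt].
by apply: le_trans (d_incr lt); have := d_step m; have := sqr_ge0 (m.+1%:R : R); lra.
Qed.

Lemma d_sqr_decay n : (d n.+1 ^+ 2 - 1)^-1 <= 2 / n.+1%:R ^+ 6.
Proof.
have D := d_ge17 n; have /andP[l _] := d_bounds n.
have x0 : 0 < n.+1%:R ^+ 3 :> R by rewrite exprn_gt0 // ltr0n.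
have -> : n.+1%:R ^+ 6 = n.+1%:R ^+ 3 * n.+1%:R ^+ 3 :> R by ring.
rewrite -[leLHS]mul1r ler_pdivrMr; last nra.
rewrite mulrAC ler_pdivlMr ?mulr_gt0 //; nra.
Qed.

Lemma inv_dB1_decay n : (d n.+1 - 1)^-1 <= 2 / n.+1%:R ^+ 3.
Proof.
have D := d_ge17 n; have /andP[l _] := d_bounds n.
have x0 : 0 < n.+1%:R ^+ 3 :> R by rewrite exprn_gt0 // ltr0n.
rewrite -[leLHS]mul1r ler_pdivrMr; last lra.
by rewrite mulrAC ler_pdivlMr //; lra.
Qed.

Lemma inv_powR_half_le (x y : R) : 0 < y -> y ^+ 2 <= x -> x^-1 `^ (1/2) <= y^-1.
Proof.
move=> y0 yx; have x0 : 0 < x by apply: lt_le_trans yx; rewrite exprn_gt0.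
have e : (y^-1 ^+ 2) `^ (1/2) = y^-1.
  rewrite -powR_mulrn ?invr_ge0 ?(ltW y0) // -powRrM.
  by rewrite (_ : 2%:R * (1/2) = 1) ?powRr1 ?invr_ge0 ?(ltW y0) //; field.
rewrite -[leRHS]e; apply: ge0_ler_powR; rewrite ?nnegrE ?exprn_ge0 ?invr_ge0 ?(ltW x0) ?(ltW y0) //.
by rewrite exprVn lef_pV2 ?posrE ?exprn_gt0.
Qed.

(** The first three terms are at most 1/16, 1/18 and 1/26. From [n = 4] on the term is at most
    [1 / ((n-1) n (n+1))], which telescopes to at most 1/24. The total is just below 1/5. *)
Lemma d_sum_half M : \sum_(n < M) (d n.+1 ^+ 2 - 1)^-1 `^ (1/2) <= 1/5.
Proof.
pose F n : R := (d n.+1 ^+ 2 - 1)^-1 `^ (1/2).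
have F0 n : 0 <= F n by exact: powR_ge0.
have Fd n : F n <= (d n.+1 - 1)^-1.
  have D := d_ge17 n; apply: inv_powR_half_le; nra.
have H m : \sum_(n < m.+3) F n <=
    1/16 + 1/18 + 1/26 + (1/24 - 1/2 / (m.+3%:R * m.+4%:R)).
  elim: m => [|m IH].
    rewrite !big_ord_recl big_ord0 /=.
    have := Fd 0%N; have := Fd 1%N; have := Fd 2%N; rewrite hd1 hd2 hd //.
    have -> : 17 - 1 = 16 :> R by ring.
    have -> : 19 - 1 = 18 :> R by ring.
    have -> : 3%:R ^+ 3 - 1 = 26 :> R by ring.
    rewrite /bump /=; lra.
  rewrite big_ord_recr /=; apply: le_trans (lerD IH (lexx _)) _.
  have x3 : 3 <= m.+3%:R :> R by rewrite ler_nat.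
  rewrite -(natr1 m.+4) -(natr1 m.+3); set x := m.+3%:R in x3 *.
  have : F m.+3 <= (x * (x + 1) * (x + 2))^-1.
    apply: inv_powR_half_le; first by rewrite !mulr_gt0; lra.
    rewrite hd // -(natr1 m.+3) -/x; nra.
  have -> : (x * (x + 1) * (x + 2))^-1 =
      1/2 / (x * (x + 1)) - 1/2 / ((x + 1) * (x + 2)).
    by field; rewrite !gt_eqF //; lra.
  rewrite (_ : x + 1 + 1 = x + 2); last by ring.
  set A := _ / (x * _); set B := _ / (_ * (x + 2)); lra.
apply: (@le_trans _ _ (\sum_(n < M.+3) F n)).
  by rewrite !big_ord_recr /= -!addrA lerDl !addr_ge0.
apply: le_trans (H M) _.
have : 0 <= 1/2 / (M.+3%:R * M.+4%:R) :> R by rewrite divr_ge0 // mulr_ge0.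
set A := 1 / 2 / _; lra.
Qed.

End Sequence.

(** * Both families are conformal systems *)

Section Systems.
Context {R : realType}.
Variable d : nat -> R.
Hypotheses (hd1 : d 1%N = 17) (hd2 : d 2%N = 19)
  (hd : forall n : nat, (3 <= n)%N -> d n = n%:R ^+ 3).
Implicit Types (a b : letter) (z w : R[i]).

Let D17 n : 17 <= d n.+1 := d_ge17 hd1 hd2 hd n.

Lemma nm_real (x : R) : nm x%:C%C = `|x|.
Proof. by rewrite /nm normc_def /= expr0n /= addr0 sqrtr_sqr. Qed.

Lemma nm_conjc z : nm (conjc z) = nm z.
Proof. by rewrite /nm normcJ. Qed.

Lemma sys_paramE a : sys_param d a = rot a.2 * (d a.1.+1)%:C%C.
Proof. by []. Qed.

Lemma nm_param a : nm (sys_param d a) = d a.1.+1.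
Proof.
rewrite sys_paramE nmM nm_rot mul1r nm_real ger0_norm //; have := D17 a.1; lra.
Qed.

Lemma nm_paramB a b : a.1 = b.1 -> a != b ->
  d a.1.+1 <= nm (sys_param d a - sys_param d b).
Proof.
move=> e ne; rewrite !sys_paramE -e -mulrBl nmM nm_real ger0_norm; last first.
  by have := D17 a.1; lra.
rewrite ler_peMl //; first by have := D17 a.1; lra.
by apply: nm_rotB; apply: contra ne => /eqP e2; rewrite -pair_eqE /pair_eq e e2 !eqxx.
Qed.

Lemma nmD_ge z w : nm w - nm z <= nm (z + w).
Proof. by have := ler_nmD (z + w) (- z); rewrite nmN addrAC subrr add0r; lra. Qed.

(** Images for different [n] lie in thin rings around radius [1 / d n]; since the terms differ by at
    least 2, the ring widths use at most half of the difference of the reciprocals. *)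
Lemma gap_of_modulus (phi : letter -> R[i] -> R[i]) :
  (forall a z, nm z <= 1/16 -> (d a.1.+1)^-1 - (d a.1.+1)^-1 ^+ 2 / 16 <= nm (phi a z)
     <= (d a.1.+1)^-1 + (d a.1.+1)^-1 ^+ 2 / 8) ->
  (forall a b z w, a.1 = b.1 -> a != b -> nm z <= 1/16 -> nm w <= 1/16 ->
     (d a.1.+1)^-1 / 2 <= nm (phi a z - phi b w)) ->
  exists2 c : R, 0 < c & forall a b z w, a != b -> nm z <= 1/16 -> nm w <= 1/16 ->
    c / a.1.+1%:R ^+ 4 <= nm (phi a z - phi b w).
Proof.
move=> hmod hsame; exists (1/34 * (1/34) / 2); first lra.
move=> a b z w ab z1 w1.
have [e|ne] := eqVneq a.1 b.1.
  apply: le_trans (hsame _ _ _ _ e ab z1 w1).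
  have /andP[_ u] := d_bounds hd1 hd2 hd a.1; have D := D17 a.1.
  have N1 : 1 <= a.1.+1%:R :> R by rewrite ler1n.
  have N3 : 1 <= a.1.+1%:R ^+ 3 :> R by rewrite exprn_ege1.
  rewrite mulrAC ler_pM2r ?invr_gt0 // ler_pdivrMr; last by rewrite exprn_gt0 ?ltr0n.
  rewrite [leRHS]mulrC ler_pdivlMr; last lra.
  rewrite exprS; nra.
apply: (@le_trans _ _ (`|(d a.1.+1)^-1 - (d b.1.+1)^-1| / 2)).
  rewrite mulrAC ler_pM2r ?invr_gt0 //; exact: d_inv_gap.
have H n m x y : (n < m)%N ->
    (d n.+1)^-1 - (d n.+1)^-1 ^+ 2 / 16 <= nm x ->
    nm y <= (d m.+1)^-1 + (d m.+1)^-1 ^+ 2 / 8 ->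
    `|(d n.+1)^-1 - (d m.+1)^-1| / 2 <= nm (x - y).
  move=> lt hx hy; have g := d_gap hd1 hd2 hd lt; have D := D17 n; have D' := D17 m.
  have hxy := nmD_ge (- y) x; rewrite nmN (addrC (- y)) in hxy; apply: le_trans hxy.
  set e := (d n.+1)^-1 in hx *; set E := (d m.+1)^-1 in hy *.
  have de : d n.+1 * e = 1 by rewrite mulfV // gt_eqF //; lra.
  have dE : d m.+1 * E = 1 by rewrite mulfV // gt_eqF //; lra.
  have e0 : 0 < e by rewrite invr_gt0; lra.
  have E0 : 0 < E by rewrite invr_gt0; lra.
  have e17 : 17 * e <= d n.+1 * e by rewrite ler_pM2r.
  rewrite de in e17.
  have h2 : 2 * (e * E) <= e - E.
    have -> : e - E = (d m.+1 - d n.+1) * (e * E).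
      transitivity (e * (d m.+1 * E) - (d n.+1 * e) * E); last by ring.
      by rewrite dE de mulr1 mul1r.
    by rewrite ler_pM2r ?mulr_gt0 //; lra.
  have eE : 0 <= e - E by apply: le_trans h2; rewrite !mulr_ge0 ?ltW.
  rewrite ger0_norm //.
  have h3 : e ^+ 2 / 16 + E ^+ 2 / 8 <= (e - E) / 2 by nra.
  lra.
have /andP[la ua] := hmod a z z1; have /andP[lb ub] := hmod b w w1.
move: ne; rewrite neq_ltn => /orP[lt|lt]; first exact: H.
by rewrite distrC nmB; apply: H.
Qed.

Lemma sum_third_gt1 (der : letter -> R[i] -> R) :
  (forall a z, nm z <= 1/16 -> ((d a.1.+1 + 1) ^+ 2)^-1 <= der a z) ->
  exists (L : seq letter) (lam : R), uniq L /\ 1 < lam /\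
    forall z, nm z <= 1/16 -> lam <= \sum_(a <- L) der a z `^ (1/3).
Proof.
(* [18^2 <= 7^3] and [20^2 <= 8^3], so the eight letters contribute at least [4/7 + 4/8 > 1]. *)
move=> h; exists (letters 2), (4/7 + 4/8); split; first exact: letters_uniq.
split; first lra.
move=> z z1.
have low (k x : R) : 0 < k -> (k ^+ 3)^-1 <= x -> k^-1 <= x `^ (1/3).
  move=> k0 kx; have e : (k^-1 ^+ 3) `^ (1/3) = k^-1.
    rewrite -powR_mulrn ?invr_ge0 ?(ltW k0) // -powRrM.
    by rewrite (_ : 3%:R * (1/3) = 1) ?powRr1 ?invr_ge0 ?(ltW k0) //; field.
  rewrite -[leLHS]e; apply: ge0_ler_powR; rewrite ?nnegrE ?exprn_ge0 ?invr_ge0 ?(ltW k0) //.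
    by apply: le_trans kx; rewrite invr_ge0 exprn_ge0 // ltW.
  by rewrite exprVn.
have h0 j : 7^-1 <= der (0%N, j) z `^ (1/3).
  apply: low => //; apply: le_trans (h _ _ z1); rewrite /= hd1.
  by rewrite lef_pV2 ?posrE ?exprn_gt0 //; lra.
have h1 j : 8^-1 <= der (1%N, j) z `^ (1/3).
  apply: low => //; apply: le_trans (h _ _ z1); rewrite /= hd2.
  by rewrite lef_pV2 ?posrE ?exprn_gt0 //; lra.
rewrite big_allpairs /= !big_cons big_nil addr0 !big_enum /=.
apply: lerD.
  apply: le_trans (ler_sum _ (fun j _ => h0 j)).
  by rewrite sumr_const card_ord -[leRHS]mulr_natl.
apply: le_trans (ler_sum _ (fun j _ => h1 j)).
by rewrite sumr_const card_ord -[leRHS]mulr_natl.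
Qed.

Lemma sum_half_lt1 (der : letter -> R[i] -> R) :
  (forall a z, nm z <= 1/16 -> 0 <= der a z) ->
  (forall n z, nm z <= 1/16 ->
    \sum_(j < 4) der (n, j) z `^ (1/2) <= 4 * (d n.+1 ^+ 2 - 1)^-1 `^ (1/2)) ->
  exists2 q : R, q < 1 & forall (L : seq letter) z, uniq L ->
    nm z <= 1/16 -> \sum_(a <- L) der a z `^ (1/2) <= q.
Proof.
move=> der0 h; exists (4/5); first lra.
move=> L z uL z1; have [M LM] := subset_letters L.
apply: le_trans (ler_sum_subset uL LM _) _ => [a|]; first exact: powR_ge0.
rewrite big_allpairs /=; under eq_bigr do rewrite big_enum /=.
have -> : iota 0 M = index_iota 0 M by rewrite /index_iota subn0.
rewrite big_mkord.
apply: (@le_trans _ _ (\sum_(n < M) 4 * (d n.+1 ^+ 2 - 1)^-1 `^ (1/2))).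
  by apply: ler_sum => n _; apply: le_trans (h n z z1).
rewrite -mulr_sumr; have := d_sum_half hd1 hd2 hd M; lra.
Qed.

Definition derF a (z : R[i]) : R := (d a.1.+1 ^+ 2 - 1)^-1.
Definition derG a (z : R[i]) : R := (nm (z + sys_param d a) ^+ 2)^-1.

Lemma FsysE a z : Fsys d 4 a z =
  (z + conjc (sys_param d a)) * (((d a.1.+1 ^+ 2 - 1)^-1)%:C%C).
Proof.
rewrite /Fsys /f_map nmE nm_param; congr (_ * _).
by rewrite fmorphV /= rmorphB rmorphXn rmorph1.
Qed.

Lemma derF_gt0 a z : 0 < derF a z.
Proof. by rewrite /derF invr_gt0; have := D17 a.1; nra. Qed.

Lemma nm_Fsys a z : nm (Fsys d 4 a z) = nm (z + conjc (sys_param d a)) * derF a z.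
Proof. by rewrite FsysE nmM nm_real ger0_norm // ltW // (derF_gt0 a z). Qed.

Lemma FsysB a z w : nm (Fsys d 4 a z - Fsys d 4 a w) = nm (z - w) * derF a z.
Proof.
rewrite !FsysE -mulrBl nmM nm_real ger0_norm ?ltW ?(derF_gt0 a z) //.
by congr (nm _ * _); ring.
Qed.

Lemma derF_decay a z : derF a z <= 2 / a.1.+1%:R ^+ 6.
Proof. exact: d_sqr_decay. Qed.

Lemma derF_le a z : derF a z <= 1/4.
Proof.
have D := D17 a.1; rewrite /derF -[leLHS]mul1r ler_pdivrMr; nra.
Qed.

Lemma Fsys_norm_le a z : nm z <= 1 -> nm (Fsys d 4 a z) <= (d a.1.+1 - 1)^-1.
Proof.
move=> z1; have D := D17 a.1; rewrite nm_Fsys /derF.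
have -> : (d a.1.+1 - 1)^-1 = (1 + d a.1.+1) / (d a.1.+1 ^+ 2 - 1).
  by field; apply/andP; split; rewrite gt_eqF //; nra.
rewrite ler_pM2r; last by rewrite invr_gt0; nra.
by apply: le_trans (ler_nmD _ _) _; rewrite nm_conjc nm_param; lra.
Qed.

Lemma Fsys_conformal : conformal_system (Fsys d 4) derF.
Proof.
split.
- move=> a z z1; apply: le_trans (Fsys_norm_le a z1) _.
  have D := D17 a.1; rewrite -[leLHS]mul1r ler_pdivrMr; lra.
- by move=> a z w _ _; rewrite FsysB exprMn -expr2.
- move=> a z w _ _; apply: ler_peMr; first exact/ltW/(derF_gt0 a w).
  by rewrite lerDl divr_ge0 ?nm_ge0.
- by move=> a z _; exact: derF_gt0.
- by move=> a z _; exact: derF_le.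
- by move=> a z _; exact: derF_decay.
- apply: gap_of_modulus => [a z z1|a b z w e ab z1 w1].
    have D := D17 a.1; rewrite nm_Fsys /derF.
    set x := d a.1.+1 in D *.
    have l := nmD_ge z (conjc (sys_param d a)); have u := ler_nmD z (conjc (sys_param d a)).
    rewrite nm_conjc nm_param -/x in l u; set y := nm (z + _) in l u *.
    have x0 : 0 < x ^+ 2 - 1 by nra.
    have xn0 : x != 0 by rewrite gt_eqF //; lra.
    have -> : x^-1 - x^-1 ^+ 2 / 16 = (x - 1/16) / x ^+ 2 by field.
    have -> : x^-1 + x^-1 ^+ 2 / 8 = (x + 1/8) / x ^+ 2 by field.
    have x2 : 0 < x ^+ 2 by rewrite exprn_gt0 //; lra.
    apply/andP; split.
      rewrite ler_pdivrMr // mulrAC ler_pdivlMr //.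
      have : (x - 1/16) * (x ^+ 2 - 1) <= (x - 1/16) * x ^+ 2 by nra.
      have : (x - 1/16) * x ^+ 2 <= y * x ^+ 2 by rewrite ler_pM2r //; lra.
      lra.
    rewrite ler_pdivrMr // mulrAC ler_pdivlMr //.
    have : y * x ^+ 2 <= (x + 1/16) * x ^+ 2 by rewrite ler_pM2r //; lra.
    nra.
  have D := D17 a.1; rewrite !FsysE -e -mulrBl nmM nm_real ger0_norm; last first.
    by rewrite ltW // (derF_gt0 a z).
  have ab' := nm_paramB e ab.
  have -> : z + conjc (sys_param d a) - (w + conjc (sys_param d b)) =
      (z - w) + conjc (sys_param d a - sys_param d b) by rewrite rmorphB; ring.
  have l := nmD_ge (z - w) (conjc (sys_param d a - sys_param d b)).
  have zw := ler_nmD z (- w); rewrite nmN in zw; rewrite nm_conjc in l.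
  set x := d a.1.+1 in D ab' *; set y := nm (_ + _) in l *.
  have yx : x - 1/8 <= y by lra.
  have x0 : 0 < x ^+ 2 - 1 by nra.
  rewrite ler_pdivlMr // -mulrA ler_pdivrMl; [nra|lra].
- move=> a z z1; apply: le_trans (Fsys_norm_le a z1) _; exact: inv_dB1_decay.
- apply: sum_third_gt1 => a z _; have D := D17 a.1.
  rewrite /derF lef_pV2 ?posrE ?exprn_gt0; nra.
- apply: sum_half_lt1 => [a z _|n z _]; first by rewrite ltW ?derF_gt0.
  by rewrite /derF /= sumr_const card_ord -[leLHS]mulr_natl.
Qed.

Lemma GsysE a z : Gsys d 4 a z = (z + sys_param d a)^-1.
Proof. by []. Qed.

Lemma param_add_ge a z : d a.1.+1 - nm z <= nm (z + sys_param d a).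
Proof. by have := nmD_ge z (sys_param d a); rewrite nm_param. Qed.

Lemma param_add_le a z : nm (z + sys_param d a) <= d a.1.+1 + nm z.
Proof. by have := ler_nmD z (sys_param d a); rewrite nm_param; lra. Qed.

Lemma param_add_ge16 a z : nm z <= 1 -> 16 <= nm (z + sys_param d a).
Proof. by move=> z1; have := param_add_ge a z; have := D17 a.1; lra. Qed.

Lemma derG_gt0 a z : nm z <= 1 -> 0 < derG a z.
Proof. by move=> z1; rewrite invr_gt0 exprn_gt0 //; have := param_add_ge16 a z1; lra. Qed.

Lemma derG_le a z : nm z <= 1 -> derG a z <= ((d a.1.+1 - 1) ^+ 2)^-1.
Proof.
move=> z1; have l := param_add_ge a z; have D := D17 a.1.
rewrite lef_pV2 ?posrE ?exprn_gt0 //; try lra.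
by rewrite ler_pXn2r ?nnegrE ?nm_ge0 //; lra.
Qed.

Lemma Gsys_norm_le a z : nm z <= 1 -> nm (Gsys d 4 a z) <= (d a.1.+1 - 1)^-1.
Proof.
move=> z1; have l := param_add_ge a z; have D := D17 a.1.
by rewrite GsysE nmV lef_pV2 ?posrE //; lra.
Qed.

Lemma nm_inv_sub z w : 0 < nm z -> 0 < nm w -> nm (z^-1 - w^-1) = nm (z - w) / (nm z * nm w).
Proof.
move=> z0 w0.
have zn : z != 0 by apply: contraTneq z0 => ->; rewrite nm0 ltxx.
have wn : w != 0 by apply: contraTneq w0 => ->; rewrite nm0 ltxx.
have -> : z^-1 - w^-1 = (w - z) * (z * w)^-1 by field; rewrite zn wn.
by rewrite nmM nmV nmM nmB.
Qed.

(* [w] and [- w] are opposite rotations of the same parameter. *)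
Lemma inv_sqr_pair_le z w : nm z <= 1/16 -> 17 <= nm w ->
  (nm (z + w) ^+ 2)^-1 + (nm (z - w) ^+ 2)^-1 <= 2 / (nm w ^+ 2 - 1/2).
Proof.
move=> z1 w17; have z0 := nm_ge0 z.
have l1 := nmD_ge z w; have l2 := nmD_ge z (- w); rewrite nmN in l2.
have s0 : nm z ^+ 2 <= 1/256 by nra.
have w2 : 289 <= nm w ^+ 2 by nra.
have p1 : 0 < nm (z + w) ^+ 2 by rewrite exprn_gt0 //; lra.
have p2 : 0 < nm (z - w) ^+ 2 by rewrite exprn_gt0 //; lra.
have z20 := sqr_ge0 (nm z).
move: p1 p2 s0 w2 z20; rewrite !nm_sqr !raddfD !raddfN /=.
set a := complex.Re z; set b := complex.Im z; set p := complex.Re w; set q := complex.Im w.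
move=> p1 p2 s0 w2 z20.
set s := a ^+ 2 + b ^+ 2 in s0 z20; set D := p ^+ 2 + q ^+ 2 in w2 *.
pose v := 2 * (a * p + b * q).
have e1 : (a + p) ^+ 2 + (b + q) ^+ 2 = s + D + v by rewrite /s /D /v; ring.
have e2 : (a - p) ^+ 2 + (b - q) ^+ 2 = s + D - v by rewrite /s /D /v; ring.
(* Cauchy-Schwarz, through the exact defect [4 (a q - b p)^2]. *)
have hv : v ^+ 2 <= 4 * (s * D).
  have : 0 <= (a * q - b * p) ^+ 2 by apply: sqr_ge0.
  have -> : 4 * (s * D) = v ^+ 2 + 4 * (a * q - b * p) ^+ 2 by rewrite /s /D /v; ring.
  lra.
rewrite e1 e2 in p1 p2 *; clearbody s D v.
have -> : (s + D + v)^-1 + (s + D - v)^-1 = 2 * (s + D) / ((s + D + v) * (s + D - v)).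
  by field; rewrite !gt_eqF.
rewrite ler_pdivrMr ?mulr_gt0 // mulrAC ler_pdivlMr; last lra.
have -> : (s + D + v) * (s + D - v) = (s + D) ^+ 2 - v ^+ 2 by ring.
suff : (s + D) * (D - 1/2) <= (s + D) ^+ 2 - v ^+ 2 by lra.
nra.
Qed.

Lemma sum_derG_le n z : nm z <= 1/16 ->
  \sum_(j < 4) derG (n, j) z <= 4 * (d n.+1 ^+ 2 - 1/2)^-1.
Proof.
move=> z1; have D := D17 n.
have ps j : sys_param d (n, j) = rot j * (d n.+1)%:C%C by [].
have pair (j k : 'I_4) : rot k = - rot j :> R[i] ->
    derG (n, j) z + derG (n, k) z <= 2 / (d n.+1 ^+ 2 - 1/2).
  move=> jk; have := @inv_sqr_pair_le z (sys_param d (n, j)) z1.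
  by rewrite /derG [sys_param d (n, k)]ps jk mulNr -ps nm_param; apply.
rewrite !big_ord_recl big_ord0 addr0.
have h02 : rot (lift ord0 (lift ord0 ord0)) = - rot ord0 :> R[i].
  by rewrite !rotE /= /bump /=; congr Complex; ring.
have h13 : rot (lift ord0 (lift ord0 (lift ord0 ord0))) = - rot (lift ord0 ord0) :> R[i].
  by rewrite !rotE /= /bump /=; congr Complex; ring.
have := pair _ _ h02; have := pair _ _ h13; lra.
Qed.

(** Concavity of [x ^ t] in tangent form at the mean bound [m]: by [powR_young],
    [x ^ t * m ^ (1 - t) <= t x + (1 - t) m]. This is summed over the four rotations. *)
Lemma sum_derG_powR_le n z t : nm z <= 1/16 -> 0 < t <= 1 ->
  \sum_(j < 4) derG (n, j) z `^ t <= 4 * (d n.+1 ^+ 2 - 1/2)^-1 `^ t.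
Proof.
move=> z1 /andP[t0 t1]; set m := (d n.+1 ^+ 2 - 1/2)^-1.
have m0 : 0 < m by rewrite invr_gt0; have := D17 n; nra.
have t01 : 0 <= t <= 1 by rewrite ltW.
have mt0 : 0 < m `^ (1 - t) by rewrite powR_gt0.
rewrite -(ler_pM2r mt0) -mulrA -powRD_gt0 // (addrC t) subrK powRr1 ?(ltW m0) //.
rewrite mulr_suml; apply: (@le_trans _ _ (\sum_(j < 4) (t * derG (n, j) z + (1 - t) * m))).
  by apply: ler_sum => j _; apply: powR_young => //; apply: derG_gt0; lra.
rewrite big_split /= -mulr_sumr sumr_const card_ord -[X in _ + X]mulr_natl.
have := sum_derG_le n z1; rewrite -/m => h.
have : t * \sum_(j < 4) derG (n, j) z <= t * (4 * m) by rewrite ler_pM2l.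
lra.
Qed.

Lemma half_lt_one_inv n : (d n.+1 ^+ 2 - 1/2)^-1 < (d n.+1 ^+ 2 - 1)^-1.
Proof. by have D := D17 n; rewrite ltf_pV2 ?posrE; nra. Qed.

Lemma Gsys_conformal : conformal_system (Gsys d 4) derG.
Proof.
split.
- move=> a z z1; apply: le_trans (Gsys_norm_le a z1) _.
  have D := D17 a.1; rewrite -[leLHS]mul1r ler_pdivrMr; lra.
- move=> a z w z1 w1; have lz := param_add_ge16 a z1; have lw := param_add_ge16 a w1.
  rewrite !GsysE nm_inv_sub; [|lra|lra].
  rewrite expr_div_n exprMn invfM /derG; congr (_ ^+ 2 * _); congr nm; ring.
- move=> a z w z1 w1; have lz := param_add_ge16 a z1; have lw := param_add_ge16 a w1.
  rewrite /derG; have tri := ler_nm_triangle (z + sys_param d a) (w + sys_param d a) 0.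
  rewrite !subr0 in tri; rewrite (_ : w + _ - _ = w - z) in tri; last by ring.
  rewrite nmB in tri; have zw := ler_nmD z (- w); rewrite nmN in zw.
  have zw0 := nm_ge0 (z - w).
  set x := nm (z + _) in lz tri *; set y := nm (w + _) in lw tri *; set u := nm (z - w) in tri zw zw0 *.
  rewrite mulrC ler_pdivlMr ?exprn_gt0 //; try lra.
  rewrite mulrC ler_pdivrMr ?exprn_gt0 //; try lra.
  (* From [y <= x + u] and [x >= 16]; as [u <= 2], the square [(1 + u/16)^2] is at most
     [1 + u/4]. *)
  have hy : y <= x * (1 + u / 16) by nra.
  apply: (@le_trans _ _ ((x * (1 + u / 16)) ^+ 2)).
    by rewrite ler_pXn2r ?nnegrE //; nra.
  rewrite exprMn mulrC ler_wpM2r ?sqr_ge0 //; nra.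
- by move=> a z z1; exact: derG_gt0.
- move=> a z z1; apply: le_trans (derG_le a z1) _; have D := D17 a.1.
  rewrite -[leLHS]mul1r ler_pdivrMr; nra.
- move=> a z z1; apply: le_trans (derG_le a z1) _; have D := D17 a.1.
  have /andP[l _] := d_bounds hd1 hd2 hd a.1.
  have x0 : 0 < a.1.+1%:R ^+ 3 :> R by rewrite exprn_gt0 // ltr0n.
  have -> : a.1.+1%:R ^+ 6 = a.1.+1%:R ^+ 3 * a.1.+1%:R ^+ 3 :> R by ring.
  rewrite -[leLHS]mul1r ler_pdivrMr; last nra.
  rewrite mulrAC ler_pdivlMr ?mulr_gt0 //; nra.
- apply: gap_of_modulus => [a z z1|a b z w e ab z1 w1].
    have D := D17 a.1; rewrite GsysE nmV.
    have l := param_add_ge a z; have u := param_add_le a z.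
    set x := d a.1.+1 in D l u *; set y := nm (z + _) in l u *.
    have xn0 : x != 0 by rewrite gt_eqF //; lra.
    have -> : x^-1 - x^-1 ^+ 2 / 16 = (x - 1/16) / x ^+ 2 by field.
    have -> : x^-1 + x^-1 ^+ 2 / 8 = (x + 1/8) / x ^+ 2 by field.
    have x2 : 0 < x ^+ 2 by rewrite exprn_gt0 //; lra.
    have y0 : 0 < y by lra.
    apply/andP; split.
      rewrite ler_pdivrMr // -[leRHS]mulrC ler_pdivlMr //; nra.
    rewrite -[leLHS]mul1r ler_pdivrMr // mulrAC ler_pdivlMr // mul1r; nra.
  have z1' : nm z <= 1 by lra.
  have w1' : nm w <= 1 by lra.
  have lz := param_add_ge16 a z1'; have lw := param_add_ge16 b w1'.
  rewrite !GsysE nm_inv_sub; [|lra|lra].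
  have ab' := nm_paramB e ab; have D := D17 a.1.
  have -> : z + sys_param d a - (w + sys_param d b) =
      (z - w) + (sys_param d a - sys_param d b) by ring.
  have l := nmD_ge (z - w) (sys_param d a - sys_param d b).
  have zw := ler_nmD z (- w); rewrite nmN in zw.
  have uz := param_add_le a z; have uw := param_add_le b w; rewrite -e in uw.
  set x := d a.1.+1 in D ab' uz uw *; set y := nm (_ + (_ - _)) in l *.
  set g := nm (z + _) in lz uz *; set k := nm (w + _) in lw uw *.
  have yx : x - 1/8 <= y by lra.
  rewrite ler_pdivlMr; last by rewrite mulr_gt0 //; lra.
  rewrite -mulrA ler_pdivrMl; last lra.
  have gk : g * k <= (x + 1/16) * (x + 1/16) by apply: ler_pM; lra.
  nra.
- move=> a z z1; apply: le_trans (Gsys_norm_le a z1) _; exact: inv_dB1_decay.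
- apply: sum_third_gt1 => a z z1; have D := D17 a.1.
  have u := param_add_le a z; have z1' : nm z <= 1 by lra.
  have l := param_add_ge16 a z1'.
  rewrite /derG lef_pV2 ?posrE ?exprn_gt0 //; try lra.
  by rewrite ler_pXn2r ?nnegrE ?nm_ge0 //; lra.
- apply: sum_half_lt1 => [a z z1|n z z1]; first by apply/ltW/derG_gt0; lra.
  apply: le_trans (sum_derG_powR_le n z1 _) _; first lra.
  rewrite ler_pM2l //; have D := D17 n.
  apply: ge0_ler_powR; rewrite ?nnegrE ?invr_ge0; try nra.
  exact/ltW/half_lt_one_inv.
Qed.

End Systems.

(** * Comparing the two dimensions *)

Section Comparison.
Context {R : realType}.
Variable d : nat -> R.
Hypotheses (hd1 : d 1%N = 17) (hd2 : d 2%N = 19)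
  (hd : forall n : nat, (3 <= n)%N -> d n = n%:R ^+ 3).
Let SF := Fsys_conformal hd1 hd2 hd.
Let SG := Gsys_conformal hd1 hd2 hd.

Lemma hdim_F_lt_half : hdim (Fsys d 4) < 1/2.
Proof.
have [q q1 hq] := cs_sum_lt1 SF.
by apply: (hdim_lt_sum SF _ q1 hq); lra.
Qed.

(** [derF] does not depend on the point, so a one-letter sum above 1 would stay above 1 at a larger
    exponent and force a larger dimension. *)
Lemma sum_derF_hdim_le1 (L : seq letter) : uniq L ->
  \sum_(a <- L) derF d a 0 `^ hdim (Fsys d 4) <= 1.
Proof.
move=> uL; rewrite leNgt; apply/negP => /sum_powR_right[a|t /andP[ht t1] h].
  by rewrite (derF_gt0 hd1 hd2 hd); have := derF_le hd1 hd2 hd a 0; lra.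
have h0 := hdim_gt0 SF; have h1 := hdim_le_half SF.
have : t <= hdim (Fsys d 4); last lra.
by apply: (hdim_ge_sum SF uL _ h) => //; lra.
Qed.

Lemma hdim_G_lt_F : hdim (Gsys d 4) < hdim (Fsys d 4).
Proof.
have h3 := hdim_ge_third SF; have h1 := hdim_le_half SF.
set h := hdim (Fsys d 4) in h3 h1 *.
pose mF n := (d n.+1 ^+ 2 - 1)^-1 `^ h; pose mG n := (d n.+1 ^+ 2 - 1/2)^-1 `^ h.
have pos n : 0 < d n.+1 ^+ 2 - 1 by have := d_ge17 hd1 hd2 hd n; nra.
have GF n : mG n < mF n.
  have p := pos n; apply: gt0_ltr_powR; rewrite ?nnegrE ?invr_ge0; try lra.
  exact: half_lt_one_inv.
(* Only the gain at the first term is kept, so that the bound is uniform over finite alphabets; it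
   is strictly below 1 by [GF]. *)
apply: (hdim_lt_sum SG (q := 1 - 4 * (mF 0%N - mG 0%N))); first lra.
  by have := GF 0%N; lra.
move=> L z uL z1; have [M LM] := subset_letters L.
(* The successor ensures that the first term of the sequence is present. *)
have LM1 : {subset L <= letters M.+1}.
  by move=> a /LM; rewrite !mem_letters => /ltnW.
apply: le_trans (ler_sum_subset uL LM1 _) _ => [a|]; first exact: powR_ge0.
have := sum_derF_hdim_le1 (letters_uniq M.+1).
rewrite !big_allpairs.
have -> : iota 0 M.+1 = index_iota 0 M.+1 by rewrite /index_iota subn0.
rewrite !big_mkord => hF.
have eF : \sum_(n < M.+1) 4 * mF n <= 1.
  apply: le_trans hF; apply: ler_sum => n _; rewrite big_enum /derF /= sumr_const card_ord.
  by rewrite -[leRHS]mulr_natl.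
apply: (@le_trans _ _ (\sum_(n < M.+1) 4 * mG n)).
  apply: ler_sum => n _; rewrite big_enum.
  by apply: (le_trans _ (sum_derG_powR_le hd1 hd2 hd n z1 _)) => //; lra.
move: eF; rewrite !big_ord_recl /=.
have : \sum_(i < M) 4 * mG (lift ord0 i) <= \sum_(i < M) 4 * mF (lift ord0 i).
  by apply: ler_sum => n _; rewrite ler_pM2l // ltW.
lra.
Qed.

End Comparison.

Theorem theorem8 (R : realType) (d : nat -> R)
  (hd1 : d 1%N = 17) (hd2 : d 2%N = 19)
  (hd : forall n : nat, (3 <= n)%N -> d n = n%:R ^+ 3) :
  let JF := limit_set (Fsys d 4) closed_disk in
  let JG := limit_set (Gsys d 4) closed_disk in
  (packing_dim JF = hausdorff_dim JF /\
   packing_measure (fine (hausdorff_dim JF)) JF = +oo%E) /\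
  (packing_dim JG = hausdorff_dim JG /\
   packing_measure (fine (hausdorff_dim JG)) JG = +oo%E) /\
  ((hausdorff_dim JG < hausdorff_dim JF)%E /\
   (hausdorff_dim JF < (1 / 2 : R)%:E)%E).
Proof.
have SF := Fsys_conformal hd1 hd2 hd; have SG := Gsys_conformal hd1 hd2 hd.
move=> JF JG; split; [|split; [|split]].
- by split; [exact: packing_dim_eq SF|exact: packing_measure_hdim SF].
- by split; [exact: packing_dim_eq SG|exact: packing_measure_hdim SG].
- by rewrite (hdimE SF) (hdimE SG) lte_fin hdim_G_lt_F.
- by rewrite (hdimE SF) lte_fin hdim_F_lt_half.
Qed.
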